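(* Let $G$ be a finite simple graph and let $M$ be a subgraph of $G$ (not necessarily induced). Let $W$ be the set of vertices $k$ of $G$ such that $ik\in E(G)$ and $jk\in E(G)$ for some edge $ij\in E(M)$, and let $G_M=G[V(M)\cup W]$. Then \[\mathrm{reg}(G)\leq\max\{\mathrm{reg}(G-M),\ \mathrm{reg}(G_M),\ \mathrm{reg}(G_M-M)+1\}.\]
   Context: All graphs are finite and simple. $G[U]$ is the induced subgraph of $G$ on the vertex set $U$. For a graph $H$ containing $M$ as a subgraph, $H-M$ is the graph obtained from $H$ by deleting all edges of $M$ (but no vertices). Fix a field $F$ of characteristic $0$. For a graph $G$ with vertex set $[n]$, the non-edge ideal is $I(G)=\langle x_ix_j : i\neq j,\ ij\notin E(G)\rangle\subseteq F[x_1,\dots,x_n]$, and $\mathrm{reg}(G):=\max\{r : \beta_{i,i+r}(I(G))\neq 0 \text{ for some } i\}$ is its Castelnuovo-Mumford regularity, where $\beta_{i,j}$ are the graded Betti numbers. If $G$ is complete (so $I(G)=0$), $\mathrm{reg}(G)=1$ by convention; the graph with no vertices is counted as complete. *)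

(* Defs.v *)
(* ssrbool.symmetric is qualified because mpoly shadows symmetric. *)
From HB Require Import structures.
From mathcomp Require Import all_boot all_order all_algebra.
From mathcomp Require Import boolp classical_sets.
From mathcomp Require Import mpoly.

Set Implicit Arguments.
Unset Strict Implicit.
Unset Printing Implicit Defensive.

Import GRing.Theory.

Local Open Scope ring_scope.

(* Graphs live in an ambient finite type, so that a graph, its subgraphs and
   its induced subgraphs all have the same type; the vertex set is explicit. *)
Record sgraph (T : finType) := SGraph {
  verts : {set T};
  adj : rel T;
  adj_sym : ssrbool.symmetric adj;
  adj_irr : irreflexive adj;
  adj_verts : forall x y, adj x y -> (x \in verts) && (y \in verts)
}.

Section GraphOps.
Variable T : finType.
Implicit Types (G H M : sgraph T) (U : {set T}).

Definition subgraph M G : Prop :=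
  verts M \subset verts G /\ (forall x y, adj M x y -> adj G x y).

Section Induced.
Variables (G : sgraph T) (U : {set T}).
Definition induced_adj : rel T :=
  fun x y => [&& x \in U, y \in U & adj G x y].
Fact induced_sym : ssrbool.symmetric induced_adj.
Proof. by move=> x y; rewrite /induced_adj adj_sym andbCA. Qed.
Fact induced_irr : irreflexive induced_adj.
Proof. by move=> x; rewrite /induced_adj adj_irr !andbF. Qed.
Fact induced_verts x y :
  induced_adj x y -> (x \in verts G :&: U) && (y \in verts G :&: U).
Proof. by case/and3P=> xU yU /adj_verts/andP[xG yG]; rewrite !inE xU yU xG yG. Qed.
Definition induced : sgraph T :=
  SGraph induced_sym induced_irr induced_verts.
End Induced.

Section DelEdges.
Variables (H M : sgraph T).
Definition del_adj : rel T := fun x y => adj H x y && ~~ adj M x y.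
Fact del_sym : ssrbool.symmetric del_adj.
Proof. by move=> x y; rewrite /del_adj adj_sym [adj M x y]adj_sym. Qed.
Fact del_irr : irreflexive del_adj.
Proof. by move=> x; rewrite /del_adj adj_irr. Qed.
Fact del_verts x y : del_adj x y -> (x \in verts H) && (y \in verts H).
Proof. by case/andP=> /adj_verts. Qed.
Definition del_edges : sgraph T := SGraph del_sym del_irr del_verts.
End DelEdges.

(* The set W of common neighbours in G of the two ends of some edge of M. *)
Definition common_nbrs G M : {set T} :=
  [set k | [exists i, exists j, [&& adj M i j, adj G i k & adj G j k]]]%SET.

Definition local_graph G M : sgraph T :=
  induced G (verts M :|: common_nbrs G M)%SET.

Definition complete G : bool :=
  [forall x in verts G, forall y in verts G, (x != y) ==> adj G x y].

End GraphOps.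

Definition ideal_gen (R : comNzRingType) (K : finType) (P : pred K) (g : K -> R) :
    set R :=
  [set f | exists c : K -> R, f = \sum_(k | P k) c k * g k]%classic.

(* The variable of index a stands for the vertex enum_val a, i.e. enum_val is
   the labelling of the vertices of G by 0, ..., #|verts G| - 1. *)
Definition nonedge_ideal (F : fieldType) (T : finType) (G : sgraph T) :
    set {mpoly F[#|verts G|]} :=
  ideal_gen
    [pred ab : 'I_#|verts G| * 'I_#|verts G| |
       (ab.1 != ab.2) && ~~ adj G (enum_val ab.1) (enum_val ab.2)]
    (fun ab => 'X_(ab.1) * 'X_(ab.2)).

(* Minimal graded free resolutions
     ... -> F_2 -> F_1 -> F_0 -> I -> 0,  F_i = \bigoplus_a S(- res_deg i a),
   of an ideal I of S = F[x_1, ..., x_n]. Elements of F_i are row vectors, and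
   the maps act by right multiplication by matrices. The homogeneity conditions
   are put on the monomials in the support, so that a zero entry is always
   allowed, and is forced where the degree shift would be negative. *)
Record min_gres (F : fieldType) (n : nat) (I : set {mpoly F[n]}) := MinGRes {
  res_rank : nat -> nat;
  res_deg : forall i, 'I_(res_rank i) -> nat;
  res_aug : 'cV[{mpoly F[n]}]_(res_rank 0);
  res_diff : forall i, 'M[{mpoly F[n]}]_(res_rank i.+1, res_rank i);
  res_aug_homog : forall a m,
    m \in msupp (res_aug a 0) -> mdeg m = res_deg a;
  res_diff_homog : forall i a b m,
    m \in msupp (res_diff i a b) -> (mdeg m + res_deg b = res_deg a)%N;
  res_aug_onto : forall f,
    I f <-> exists v : 'rV_(res_rank 0), f = (v *m res_aug) 0 0;
  res_exact0 : forall v : 'rV_(res_rank 0),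
    v *m res_aug = 0 <-> exists w : 'rV_(res_rank 1), v = w *m res_diff 0;
  res_exactS : forall i (v : 'rV_(res_rank i.+1)),
    v *m res_diff i = 0 <->
    exists w : 'rV_(res_rank i.+2), v = w *m res_diff i.+1;
  (* minimality: F_i.+1 is mapped into (x_1, ..., x_n) F_i *)
  res_minimal : forall i a b, (res_diff i a b)@_0%MM = 0
}.

(* beta_{i,j}(I): the number of summands S(-j) of F_i in a minimal graded free
   resolution of I. For a homogeneous ideal I such a resolution exists and this
   number does not depend on it; 0 is a dummy value for other sets I. *)
Definition betti (F : fieldType) (n : nat) (I : set {mpoly F[n]}) (i j : nat) :
    nat :=
  xget 0%N [set b | exists R : min_gres I,
    b = #|[set a : 'I_(res_rank R i) | res_deg a == j]%SET| ]%classic.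

(* max A for a nonempty bounded A, and 0 otherwise *)
Definition max_nat (A : set nat) : nat :=
  xget 0%N [set r | A r /\ forall s, A s -> (s <= r)%N]%classic.

Arguments nonedge_ideal F {T} G.

Definition reg (F : fieldType) (T : finType) (G : sgraph T) : nat :=
  if complete G then 1%N
  else max_nat
    [set r | exists i : nat, betti (nonedge_ideal F G) i (i + r) <> 0%N]%classic.

Arguments reg F {T} G.

(* Main.v *)
Require Import Defs.
From mathcomp Require Import all_boot all_order all_algebra.
From mathcomp Require Import boolp classical_sets mpoly.
(* Reimported last: classical_sets shadows their lemma names. *)
From mathcomp Require Import fintype finset ring zify.

Set Implicit Arguments.
Unset Strict Implicit.
Unset Printing Implicit Defensive.

Import Order.TTheory GRing.Theory.

(** The Betti number of I(G) in homological degree i and internal degree i + r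
    is nonzero if and only if some vertex set U makes the reduced cohomology of
    the clique complex of G[U] nonzero on faces with r - 1 vertices (Hochster).
    A clique of G contains no edge of M, or else it lies in V(M) and W; so the
    clique complex of G is the union of those of G - M and G_M, which meet in
    that of G_M - M, and the Mayer-Vietoris sequence of their restrictions to U
    gives the inequality.

    Hochster's criterion is read off from Koszul homology: a minimal graded
    resolution shifts its syzygy modules into one another, so that a generator
    of degree j in F_i is the same as a nonzero class of Koszul homology
    H_i(I) in degree j. This class may be taken of squarefree multidegree U,
    where the Koszul complex is the cochain complex of the full simplex on U
    relative to the clique complex. *)

Local Open Scope ring_scope.

Section Cochains.
Variables (R : comNzRingType) (K : finType) (rho : K -> nat).
Hypothesis rho_inj : injective rho.
Implicit Types (f g : {set K} -> R) (B C U : {set K}).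

Definition csgn (k : K) B : R := (-1) ^+ #|[set j in B | (rho j < rho k)%N]|.

Definition cobd f B : R := \sum_(l in B) csgn l (B :\ l) * f (B :\ l).

Definition cone (k : K) f B : R := if k \in B then 0 else csgn k B * f (k |: B).

Lemma csgn2 k B : csgn k B * csgn k B = 1.
Proof. by rewrite -exprD addnn -signr_odd odd_double. Qed.

Lemma csgnU1 k l B : k \notin B ->
  csgn l (k |: B) = (-1) ^+ (rho k < rho l)%N * csgn l B.
Proof.
move=> kB; rewrite /csgn -exprD; congr (_ ^+ _).
case h: (rho k < rho l)%N.
  rewrite (_ : [set j in k |: B | _] = k |: [set j in B | (rho j < rho l)%N]).
    by rewrite cardsU1 inE (negPf kB).
  apply/setP=> j; rewrite !inE; case: eqP => [->|] //=; by rewrite h.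
rewrite add0n; apply: eq_card => j; rewrite !inE.
by case: eqP => [->|//]; rewrite h (negPf kB).
Qed.

Lemma csgnC k l C : k != l -> k \notin C -> l \notin C ->
  csgn l (k |: C) * csgn k C = - (csgn k (l |: C) * csgn l C).
Proof.
move=> kl kC lC; rewrite !csgnU1 //.
have : rho k != rho l by rewrite (inj_eq rho_inj).
by case: ltngtP => // _ _; rewrite !(expr0, expr1); ring.
Qed.

Lemma cobdB f g B : cobd (fun C => f C - g C) B = cobd f B - cobd g B.
Proof. by rewrite -sumrB; apply: eq_bigr => l _; rewrite mulrBr. Qed.

Lemma eq_cobd f g B : (forall l, l \in B -> f (B :\ l) = g (B :\ l)) ->
  cobd f B = cobd g B.
Proof. by move=> fg; apply: eq_bigr => l lB; rewrite fg. Qed.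

Lemma cobdK f B : cobd (cobd f) B = 0.
Proof.
rewrite /cobd; under eq_bigr => l _ do rewrite big_distrr /=.
have -> : \sum_(l in B) \sum_(k in B :\ l)
    csgn l (B :\ l) * (csgn k (B :\ l :\ k) * f (B :\ l :\ k)) =
  \sum_(l in B) \sum_(k in B | (rho k < rho l)%N)
    (csgn l (B :\ l) * (csgn k (B :\ l :\ k) * f (B :\ l :\ k))
     + csgn k (B :\ k) * (csgn l (B :\ k :\ l) * f (B :\ k :\ l))).
  under [RHS]eq_bigr => l _ do rewrite big_split /=.
  rewrite big_split /= [X in _ = _ + X](exchange_big_dep (mem B)) /=; last first.
    by move=> l k _ /andP[].
  rewrite -big_split /=; apply: eq_bigr => l lB.
  rewrite (bigID (fun k => (rho k < rho l)%N)) /=; congr (_ + _).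
    apply: eq_bigl => k; rewrite !inE; case: eqP => [->|_] //=.
    by rewrite ltnn andbF.
  apply: eq_bigl => k; rewrite !inE -leqNgt leq_eqVlt eq_sym (inj_eq rho_inj).
  by rewrite lB; case: eqP => [->|]; rewrite ?ltnn ?andbF //= andbC.
rewrite big1 // => l lB; rewrite big1 // => k /andP[kB kl].
have nkl : k != l by apply: contraTneq kl => ->; rewrite ltnn.
have E : B :\ k :\ l = B :\ l :\ k by apply/setP=> x; rewrite !inE andbCA.
have := @csgnC k l (B :\ l :\ k) nkl; rewrite !inE eqxx /= => /(_ isT).
rewrite E eqxx andbF => /(_ isT) H.
rewrite !mulrA -mulrDl.
have -> : B :\ l = k |: (B :\ l :\ k) by rewrite setD1K // !inE nkl kB.
have -> : B :\ k = l |: (B :\ l :\ k).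
  by rewrite -E setD1K // !inE eq_sym nkl lB.
have E2 : (l |: B :\ l :\ k) :\ l = B :\ l :\ k.
  by rewrite setU1K // !inE eqxx andbF.
have E3 : (k |: B :\ l :\ k) :\ k = B :\ l :\ k.
  by rewrite setU1K // !inE eqxx.
by rewrite ?E2 ?E3 H addrC subrr mul0r.
Qed.

Lemma coneP k f B : cobd (cone k f) B + cone k (cobd f) B = f B.
Proof.
case: (boolP (k \in B)) => kB.
  rewrite [cone k (cobd f) B]/cone kB addr0 /cobd (bigD1 k) //= big1; last first.
    by move=> l /andP[lB lk]; rewrite /cone !inE kB eq_sym lk mulr0.
  rewrite addr0 /cone !inE eqxx /= mulrA csgn2 mul1r.
  by rewrite setD1K.
rewrite [cone k (cobd f) B]/cone (negPf kB) /cobd big_setU1 //=.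
rewrite setU1K // mulrDr mulrA csgn2 mul1r addrCA.
rewrite [X in _ + X](_ : _ = 0) ?addr0 //.
rewrite big_distrr -big_split /= big1 // => l lB.
have kl : k != l by apply: contraNneq kB => ->.
rewrite /cone !inE (negPf kB) andbF.
have -> : (k |: B) :\ l = k |: (B :\ l).
  by apply/setP=> x; rewrite !inE; case: (x =P k) => [->|//]; rewrite kl.
rewrite !mulrA -mulrDl.
have := @csgnC k l (B :\ l) kl; rewrite !inE eqxx (negPf kB) andbF => /(_ isT isT).
rewrite setD1K // [csgn l _ * csgn k _]mulrC => H.
have c2 := csgn2 k (B :\ l); have d2 := csgn2 k B.
have -> : csgn k B * csgn l (k |: B :\ l) = - (csgn l (B :\ l) * csgn k (B :\ l)).
  rewrite -[csgn l (k |: _)]mul1r -c2 -mulrA H mulrN mulrN; congr (- _).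
  by rewrite mulrCA [csgn k B * (_ * _)]mulrA d2 mul1r mulrC.
by rewrite subrr mul0r.
Qed.

Lemma cone_exact k U f B : k \in U -> B \subset U ->
  (forall C, C \subset U -> #|C| = #|B|.+1 -> cobd f C = 0) ->
  cobd (cone k f) B = f B.
Proof.
move=> kU BU df; rewrite -[RHS](coneP k) [cone k (cobd f) B]/cone.
case: ifPn => kB; first by rewrite addr0.
by rewrite df ?mulr0 ?addr0 ?cardsU1 ?kB // subUset sub1set kU.
Qed.

End Cochains.

Section SimplicialCohomology.
Variables (R : comNzRingType) (K : finType) (rho : K -> nat).
Hypothesis rho_inj : injective rho.
Implicit Types (f g : {set K} -> R) (B C U : {set K}) (D : pred {set K}).

Definition down_closed D := forall B C, C \subset B -> D B -> D C.

(* The reduced cohomology of the complex D is nonzero on faces with k vertices;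
   only the values of the cochain on faces of D matter. *)
Definition coh_nz D k : Prop :=
  exists f : {set K} -> R,
    (forall B, D B -> #|B| = k.+1 -> cobd rho f B = 0) /\
    ~ exists g, forall B, D B -> #|B| = k -> f B = cobd rho g B.

(* Nonvanishing cohomology of the full simplex on U relative to D. *)
Definition relcoh_nz D U k : Prop :=
  exists f : {set K} -> R,
    [/\ forall B, B \subset U -> D B -> #|B| = k -> f B = 0,
        forall B, B \subset U -> #|B| = k.+1 -> cobd rho f B = 0 &
        ~ exists g, (forall B, B \subset U -> D B -> #|B|.+1 = k -> g B = 0) /\
                    (forall B, B \subset U -> #|B| = k -> f B = cobd rho g B)].

Lemma eq_coh_nz D1 D2 k : D1 =1 D2 -> coh_nz D1 k -> coh_nz D2 k.
Proof.
move=> E [f [df nf]]; exists f; split=> [B|[g gP]]; first by rewrite -E; exact: df.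
by apply: nf; exists g => B; rewrite E; exact: gP.
Qed.

Lemma coh_relcoh D U k : down_closed D -> U != set0 ->
  coh_nz (fun B => D B && (B \subset U)) k <-> relcoh_nz D U k.+1.
Proof.
move=> dD /set0Pn[x0 x0U]; split.
  case=> z [dz nz]; pose z' B := if D B then z B else 0.
  exists (cobd rho z'); split=> [B BU DB cB|B _ _|[g [g0 gP]]].
  - rewrite -(dz B) ?DB //; apply: eq_cobd => l lB.
    by rewrite /z' (dD B) // subD1set.
  - exact: cobdK.
  apply: nz; exists (cone rho x0 (fun B => z' B - g B)) => B /andP[DB BU] cB.
  rewrite (cone_exact rho_inj x0U BU); first by rewrite /z' DB g0 ?subr0 ?cB.
  by move=> C CU cC; rewrite cobdB -gP ?subrr // cC cB.
case=> f [f0 df nf]; pose g := cone rho x0 f.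
have fg B : B \subset U -> #|B| = k.+1 -> cobd rho g B = f B.
  move=> BU cB; rewrite (cone_exact rho_inj x0U BU) // => C CU cC.
  by rewrite df // cC cB.
exists g; split=> [B /andP[DB BU] cB|[h hP]]; first by rewrite fg ?f0.
apply: nf; exists (fun B => g B - cobd rho h B).
split=> [B BU DB [cB]|B BU cB]; first by rewrite hP ?DB // subrr.
by rewrite cobdB (cobdK rho_inj) subr0 fg.
Qed.

Lemma mayer_vietoris D D1 D2 k : down_closed D1 -> down_closed D2 ->
  (forall B, D B = D1 B || D2 B) -> coh_nz D k.+1 ->
  [\/ coh_nz D1 k.+1, coh_nz D2 k.+1 | coh_nz (fun B => D1 B && D2 B) k].
Proof.
move=> dD1 dD2 DE [z [dz nz]].
have [nz1|/contrapT[g1 g1P]] :=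
    pselect (~ exists g, forall B, D1 B -> #|B| = k.+1 -> z B = cobd rho g B).
  by constructor 1; exists z; split=> // B DB; apply: dz; rewrite DE DB.
have [nz2|/contrapT[g2 g2P]] :=
    pselect (~ exists g, forall B, D2 B -> #|B| = k.+1 -> z B = cobd rho g B).
  by constructor 2; exists z; split=> // B DB; apply: dz; rewrite DE DB orbT.
constructor 3; exists (fun B => g1 B - g2 B); split.
  by move=> B /andP[D1B D2B] cB; rewrite cobdB -g1P // -g2P // subrr.
case=> h hP; apply: nz.
exists (fun B => if D1 B then g1 B - cobd rho h B else g2 B) => B.
have [D1B _ cB|ND1B] := boolP (D1 B).
  rewrite (@eq_cobd _ _ rho _ (fun B => g1 B - cobd rho h B)); last first.
    by move=> l lB; rewrite (dD1 B) // subD1set.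
  by rewrite cobdB (cobdK rho_inj) subr0 g1P.
rewrite DE (negPf ND1B) /= => D2B cB; rewrite g2P //; apply: eq_cobd => l lB.
case: ifP => // D1Bl; rewrite -hP; first by rewrite opprB addrC subrK.
  by rewrite D1Bl (dD2 B) // subD1set.
by move: cB; rewrite (cardsD1 l B) lB => -[].
Qed.

Lemma coh_simplex U k : ~ coh_nz (fun B => B \subset U) k.+1.
Proof.
case=> f [df nf]; apply: nf.
have [->|/set0Pn[x xU]] := eqVneq U set0.
  by exists f => B; rewrite subset0 => /eqP ->; rewrite cards0.
exists (cone rho x f) => B BU cB; rewrite (cone_exact rho_inj xU BU) // => C CU cC.
by rewrite df // cC cB.
Qed.

Lemma coh_two_points D a b : a != b -> D [set a] -> D [set b] -> ~~ D [set a; b] ->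
  coh_nz (fun B => D B && (B \subset [set a; b])) 1.
Proof.
move=> ab Da Db Dab; exists (fun B => if B == [set a] then 1 else 0); split.
  move=> B /andP[DB sB] cB; move: sB Dab; rewrite subEproper.
  case/orP=> [/eqP <-|/proper_card]; first by rewrite DB.
  by rewrite cB cards2 ab.
case=> g gP; have := gP [set a]; have := gP [set b].
have c0 (x : K) : cobd rho g [set x] = g set0.
  rewrite /cobd big_set1 setDv /csgn.
  by rewrite (eq_card0 (A := [set _ | _])) ?mul1r // => j; rewrite !inE.
rewrite !cards1 !c0 Da Db !sub1set !inE !eqxx orbT (inj_eq set1_inj) eq_sym.
rewrite (negPf ab) => /(_ isT erefl) <- /(_ isT erefl) /eqP.
by rewrite oner_eq0.
Qed.

End SimplicialCohomology.

Section Relabelling.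
Variables (R : comNzRingType) (K T : finType) (rho : T -> nat) (e : K -> T).
Hypothesis e_inj : injective e.
Let rhoK := rho \o e.

Lemma cobd_imset (f : {set T} -> R) (B : {set K}) :
  cobd rho f (e @: B) = cobd rhoK (fun C : {set K} => f (e @: C)) B.
Proof.
rewrite /cobd big_imset /=; last by move=> x y _ _; exact: e_inj.
apply: eq_bigr => l lB.
have -> : (e @: B) :\ e l = e @: (B :\ l).
  apply/setP=> y; apply/setD1P/imsetP=> [[nyl /imsetP[x xB yE]]|[x]].
    by exists x => //; rewrite !inE xB andbT; apply: contraNneq nyl => <-; apply/eqP.
  rewrite !inE => /andP[xl xB] ->; rewrite (inj_eq e_inj); split=> //.
  exact: imset_f.
congr ((-1) ^+ _ * _); rewrite -(card_imset _ e_inj).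
apply: eq_card => y; rewrite inE; apply/andP/imsetP=> [[/imsetP[x xB ->] h]|].
  by exists x => //; rewrite inE xB.
by case=> x; rewrite inE => /andP[xB h] ->; rewrite imset_f.
Qed.

Lemma coh_nz_imset (D : pred {set T}) k :
  (forall B, D B -> B \subset e @: [set: K]) ->
  coh_nz R rho D k <-> coh_nz R rhoK (fun B => D (e @: B)) k.
Proof.
move=> De.
have eK (B : {set T}) : D B -> e @: (e @^-1: B) = B.
  move=> /De/subsetP sB; apply/setP=> y; apply/imsetP/idP=> [[x]|yB].
    by rewrite inE => ? ->.
  by have /imsetP[x _ yE] := sB y yB; exists x => //; rewrite inE -yE.
have Ke (B : {set K}) : e @^-1: (e @: B) = B.
  by apply/setP=> x; rewrite inE mem_imset.
split=> -[f [df nf]].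
  exists (fun B : {set K} => f (e @: B)); split=> [B DB cB|[g gP]].
    by rewrite -cobd_imset df // card_imset.
  apply: nf; exists (fun B : {set T} => g (e @^-1: B)) => B DB cB.
  rewrite -(eK _ DB) cobd_imset (@eq_cobd _ _ _ _ g); last by move=> l _; rewrite Ke.
  by rewrite -gP ?eK // -(card_imset _ e_inj) eK.
exists (fun B : {set T} => f (e @^-1: B)); split=> [B DB cB|[g gP]].
  rewrite -(eK _ DB) cobd_imset (@eq_cobd _ _ _ _ f); last by move=> l _; rewrite Ke.
  by rewrite df ?eK // -(card_imset _ e_inj) eK.
apply: nf; exists (fun B : {set K} => g (e @: B)) => B DB cB.
by rewrite -cobd_imset -gP ?Ke // card_imset.
Qed.

End Relabelling.
Section Koszul.
Variables (F : fieldType) (n : nat) (rho : 'I_n -> nat).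
Hypothesis rho_inj : injective rho.
Local Notation S := {mpoly F[n]}.
Implicit Types (A B U : {set 'I_n}) (x y : {set 'I_n} -> S) (b m : 'X_{1..n}).

Definition koszul x A : S :=
  \sum_(l | l \notin A) csgn F rho l A *: ('X_l * x (l |: A)).

Definition mnm_supp m : {set 'I_n} := [set i | m i != 0%N].

Definition twist U B : F := \prod_(l in B) csgn F rho l U.

(* The part of a Koszul chain of multidegree b, indexed by complements in the
   support U of b; the twist turns the Koszul differential into cobd. *)
Definition slice b x B : F :=
  twist (mnm_supp b) B *
  (x (mnm_supp b :\: B))@_(b - mesym1 (mnm_supp b :\: B)).

Lemma mcoeffXM (p : S) l m :
  ('X_l * p)@_m = if m l == 0%N then 0 else p@_(m - U_(l)).
Proof.
rewrite mulrC; case: eqP => [ml|/eqP ml].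
  apply: memN_msupp_eq0; rewrite (perm_mem (msuppMX _ _)); apply/mapP=> -[m' _ mE].
  by move: ml; rewrite mE mnmDE mnm1E eqxx.
have /submK {1}<- : (U_(l) <= m)%MM by rewrite lep1mP.
by rewrite addmC mcoeffMX.
Qed.

Lemma twist2 U B : twist U B * twist U B = 1.
Proof. by rewrite -big_split big1 //= => l _; rewrite csgn2. Qed.

Lemma csgn_split U B l : B \subset U -> l \in B ->
  csgn F rho l U = csgn F rho l (U :\: B) * csgn F rho l (B :\ l).
Proof.
move=> /subsetP BU lB; rewrite /csgn -exprD; congr (_ ^+ _).
rewrite -cardsUI [X in _ = (_ + X)%N]eq_card0 ?addn0.
  apply: eq_card => j; rewrite !inE; have := BU j.
  case: (j \in B) => [->|_] //=; last by rewrite ?andbF ?orbF.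
  by case: eqP => [->|_] /=; rewrite ?ltnn ?andbF.
by move=> j; rewrite !inE; case: (j \in B); rewrite ?andbF.
Qed.

Lemma slice_koszul b x B : B \subset mnm_supp b ->
  slice b (koszul x) B = cobd rho (slice b x) B.
Proof.
move=> BU; rewrite /slice /koszul /cobd; set U := mnm_supp b in BU *.
rewrite raddf_sum /= big_distrr /= (bigID (fun l => l \in B)) /=.
rewrite [X in _ + X]big1 ?addr0; last first.
  move=> l /andP[lUB lB]; rewrite mcoeffZ mcoeffXM mnmBE.
  by move: lUB; rewrite !inE (negPf lB) /= negbK => /eqP ->; rewrite !mulr0.
apply: eq_big => [l|l /andP[lUB lB]].
  by rewrite !inE; case: (l \in B); rewrite ?andbF.
have lU : l \in U by apply: (subsetP BU).
have bl : b l != 0%N by move: lU; rewrite inE.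
have -> : U :\: (B :\ l) = l |: U :\: B.
  by apply/setP=> j; rewrite !inE; case: eqP => [->|_] //=; rewrite bl.
rewrite mcoeffZ mcoeffXM mnmBE mnmE inE lB /= subn0.
rewrite (negPf bl).
have -> : (b - mesym1 (U :\: B) - U_(l))%MM = (b - mesym1 (l |: U :\: B))%MM.
  apply/mnmP=> j; rewrite !mnmBE !mnmE !inE -subnDA [j == l]eq_sym; congr (_ - _)%N.
  by case: (eqVneq l j) => [<-|_] /=; rewrite ?lB ?addn0.
rewrite {1}/twist (big_setD1 l lB) /= -/(twist U _) (csgn_split BU lB).
by rewrite !mulrA; congr (_ * _); rewrite -[RHS]mul1r -(csgn2 F rho l (U :\: B)); ring.
Qed.

Lemma mnm_suppD A m : mnm_supp (m + mesym1 A)%MM = A :|: mnm_supp m.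
Proof.
by apply/setP=> j; rewrite !inE mnmDE mnmE addn_eq0; case: (j \in A); rewrite ?andbF ?andbT.
Qed.

Lemma mcoeff_slice x A m : let b := (m + mesym1 A)%MM in
  let B := mnm_supp b :\: A in (x A)@_m = twist (mnm_supp b) B * slice b x B.
Proof.
move=> b B; rewrite /slice mulrA twist2 mul1r.
have -> : mnm_supp b :\: B = A.
  by rewrite setDDr setDv set0U mnm_suppD; apply/setIidPr; exact: subsetUl.
by rewrite addmK.
Qed.

Lemma slice_neq0 b x B : slice b x B != 0 -> let A := mnm_supp b :\: B in
  exists2 m, m \in msupp (x A) & b = (m + mesym1 A)%MM.
Proof.
rewrite /slice mulf_eq0 negb_or => /andP[_]; rewrite -mcoeff_msupp => h.
pose A := mnm_supp b :\: B; exists (b - mesym1 A)%MM => //; rewrite submK //.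
by apply/mnm_lepP=> i; rewrite mnmE !inE; case: (i \in B); case: (b i).
Qed.

Lemma slice_inj x y :
  (forall b B, B \subset mnm_supp b -> slice b x B = slice b y B) -> x =1 y.
Proof.
move=> xy A; apply/mpolyP=> m; rewrite !mcoeff_slice xy //.
exact: subsetDl.
Qed.

Lemma slice_surj N (g : 'X_{1..n} -> {set 'I_n} -> F) :
  (forall b B, (N <= mdeg b)%N -> g b B = 0) ->
  exists x, (forall b B, B \subset mnm_supp b -> slice b x B = g b B) /\
    (forall A m, (x A)@_m != 0 ->
       g (m + mesym1 A)%MM (mnm_supp (m + mesym1 A)%MM :\: A) != 0).
Proof.
move=> g0; pose E A m := let b := (m + mesym1 A)%MM in
  let B := mnm_supp b :\: A in twist (mnm_supp b) B * g b B.
pose x A : S := \sum_(m : 'X_{1..n < N}) E A m *: 'X_[m].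
have xE A m : (x A)@_m = E A m.
  have [lt_mN|le_Nm] := ltnP (mdeg m) N; first by rewrite mcoeff_mpoly.
  rewrite /E /= g0 ?mulr0; last by rewrite mdegD (leq_trans le_Nm) // leq_addr.
  rewrite raddf_sum /= big1 // => m' _; rewrite mcoeffZ mcoeffX.
  case: eqP => [mm'|_]; last by rewrite mulr0.
  by move: (bmdeg m'); rewrite mm' ltnNge le_Nm.
exists x; split=> [b B BU|A m]; last by rewrite xE /E /= mulf_eq0 negb_or => /andP[].
have sb : (mesym1 (mnm_supp b :\: B) <= b)%MM.
  by apply/mnm_lepP=> i; rewrite mnmE !inE; case: (i \in B); case: (b i).
rewrite /slice xE /E /= submK //.
have -> : mnm_supp b :\: (mnm_supp b :\: B) = B.
  by rewrite setDDr setDv set0U; apply/setIidPr.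
by rewrite mulrA twist2 mul1r.
Qed.

Lemma koszulK x A : koszul (koszul x) A = 0.
Proof.
suff /(_ A) -> : koszul (koszul x) =1 fun _ => 0 by [].
apply: slice_inj => b B BU; rewrite slice_koszul //.
rewrite {2}/slice mcoeff0 mulr0 -[RHS](cobdK rho_inj (slice b x) B).
apply: eq_cobd => l lB; apply: slice_koszul.
by rewrite (subset_trans (subD1set _ _)).
Qed.

Lemma koszulB x y A : koszul (fun C => x C - y C) A = koszul x A - koszul y A.
Proof. by rewrite -sumrB; apply: eq_bigr => l _; rewrite mulrBr scalerBr. Qed.

Lemma mcoeff0_koszul x A : (koszul x A)@_0 = 0.
Proof.
by rewrite raddf_sum big1 //= => l _; rewrite mcoeffZ mcoeffXM mnmE mulr0.
Qed.

(* A homotopy: on the part of multidegree b, contract along a variable that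
   occurs in b. *)
Lemma koszul_exact x : (forall A, koszul x A = 0) -> (x set0)@_0 = 0 ->
  exists h, (forall A, koszul h A = x A) /\
    forall p (Q : pred nat),
      (forall A m, m \in msupp (x A) -> #|A| = p /\ Q (mdeg m + #|A|)%N) ->
      (forall A m, m \in msupp (h A) -> #|A| = p.+1 /\ Q (mdeg m + #|A|)%N).
Proof.
move=> dx x0.
pose g b B := if [pick k in mnm_supp b] is Some k then cone rho k (slice b x) B else 0.
pose N := (\max_A msize (x A) + n)%N.
have [b B|h [hg hsupp]] := @slice_surj N g.
  move=> leN; rewrite /g; case: pickP => // k _; rewrite /cone.
  case: ifP => // _; case: (eqVneq (slice b x (k |: B)) 0) => [->|]; first by rewrite mulr0.
  case/slice_neq0 => m mx bE; move: leN; rewrite bE mdegD mdeg_mesym1 /N leqNgt.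
  rewrite -addSn leq_add //; last by rewrite -[X in (_ <= X)%N]card_ord max_card.
  rewrite (leq_trans (msize_mdeg_lt mx)) //.
  exact: (leq_bigmax (F := fun A => msize (x A))).
exists h; split=> [A|p Q xpQ A m].
  move: A; apply: slice_inj => b B BU; rewrite slice_koszul //.
  rewrite (@eq_cobd _ _ _ _ (g b)); last first.
    by move=> l lB; rewrite hg // (subset_trans (subD1set _ _)).
  rewrite /g; case: pickP => [k kU|U0].
    apply: (cone_exact rho_inj kU BU) => C CU _.
    by rewrite -slice_koszul // /slice dx mcoeff0 mulr0.
  have b0 : b = 0%MM.
    by apply/mnmP=> i; have := U0 i; rewrite inE mnm0E => /negbFE/eqP.
  move: BU; have -> : mnm_supp b = set0 by apply/setP=> i; rewrite U0 inE.
  rewrite subset0 => /eqP ->; rewrite /cobd big_set0 /slice.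
  have -> : mnm_supp b :\: set0 = set0 by apply/setP=> i; rewrite inE U0 !inE.
  by rewrite b0 sub0m x0 mulr0.
rewrite mcoeff_msupp => /hsupp; set b := (m + _)%MM; rewrite /g.
case: pickP => [k kb|]; last by rewrite eqxx.
rewrite /cone; case: ifP; first by rewrite eqxx.
rewrite inE kb andbT => /negbFE kA; rewrite mulf_eq0 negb_or => /andP[_].
case/slice_neq0=> m'; have -> : mnm_supp b :\: (k |: mnm_supp b :\: A) = A :\ k.
  apply/setP=> j; rewrite in_setD in_setU1 !in_setD in_set1 mnm_suppD in_setU.
  by case: (j \in A); case: (j == k); case: (j \in mnm_supp m).
move=> /xpQ[cA Qm'] bE; rewrite (cardsD1 k) kA cA; split=> //.
have -> : (true + p = #|A|)%N by rewrite (cardsD1 k A) kA cA.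
by move: Qm'; rewrite -!mdeg_mesym1 -!mdegD -bE.
Qed.

End Koszul.
Section GradedModules.
Variables (F : fieldType) (n : nat).
Local Notation S := {mpoly F[n]}.

Definition mfilter (P : pred 'X_{1..n}) (p : S) : S :=
  \sum_(m <- msupp p | P m) p@_m *: 'X_[m].

Lemma mcoeff_filter P p m : (mfilter P p)@_m = if P m then p@_m else 0.
Proof.
rewrite raddf_sum /= -big_filter.
under eq_bigr => k _ do rewrite mcoeffZ mcoeffX.
have [|mNp] := boolP (m \in [seq k <- msupp p | P k]).
  move=> mp; rewrite (big_rem m) //= eqxx mulr1 big_seq big1 ?addr0.
    by move: mp; rewrite mem_filter => /andP[->].
  move=> k; rewrite mem_rem_uniq ?filter_uniq ?msupp_uniq // inE => /andP[km _].
  by rewrite (negPf km) mulr0.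
rewrite big_seq big1 => [|k kp]; last first.
  by case: eqP kp mNp => [-> ->|]; rewrite ?mulr0.
move: mNp; rewrite mem_filter; case: (P m) => //= /memN_msupp_eq0 //.
Qed.

(* The b-th basis vector has degree e b. *)
Definition row_degs q (e : 'I_q -> nat) (Q : pred nat) (v : 'rV[S]_q) : Prop :=
  forall b m, m \in msupp (v 0 b) -> Q (mdeg m + e b)%N.

Definition row_filter q (e : 'I_q -> nat) (Q : pred nat) (v : 'rV[S]_q) :=
  \row_b mfilter (fun m => Q (mdeg m + e b)%N) (v 0 b).

Definition homog_mx r q (e : 'I_r -> nat) (e' : 'I_q -> nat) (phi : 'M[S]_(r, q)) :=
  forall a b m, m \in msupp (phi a b) -> (mdeg m + e' b = e a)%N.

Definition mx_image r q (phi : 'M[S]_(r, q)) (v : 'rV[S]_q) : Prop :=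
  exists w, v = w *m phi.

Definition mx_kernel r q (phi : 'M[S]_(r, q)) (w : 'rV[S]_r) : Prop :=
  w *m phi = 0.

Lemma row_filter_degs q (e : 'I_q -> nat) Q v : row_degs e Q (row_filter e Q v).
Proof.
by move=> b m; rewrite mcoeff_msupp mxE mcoeff_filter; case: ifP; rewrite ?eqxx.
Qed.

Lemma row_filterC q (e : 'I_q -> nat) Q v :
  row_filter e Q v + row_filter e (predC Q) v = v.
Proof.
apply/rowP=> b; rewrite !mxE; apply/mpolyP=> m; rewrite mcoeffD !mcoeff_filter /=.
by case: ifP; rewrite /= ?addr0 ?add0r.
Qed.

Lemma row_filter_id q (e : 'I_q -> nat) Q v : row_degs e Q v -> row_filter e Q v = v.
Proof.
move=> vQ; apply/rowP=> b; rewrite mxE; apply/mpolyP=> m; rewrite mcoeff_filter.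
case: ifP => // Qm; apply/esym/memN_msupp_eq0; apply: contraFN Qm; exact: vQ.
Qed.

Lemma row_filter0 q (e : 'I_q -> nat) Q v : row_degs e (predC Q) v ->
  row_filter e Q v = 0.
Proof.
move=> vQ; apply/rowP=> b; rewrite !mxE; apply/mpolyP=> m; rewrite mcoeff_filter mcoeff0.
case: ifP => // Qm; apply/memN_msupp_eq0; apply: contraTN Qm; exact: vQ.
Qed.

Lemma row_filterD q (e : 'I_q -> nat) Q v w :
  row_filter e Q (v + w) = row_filter e Q v + row_filter e Q w.
Proof.
apply/rowP=> b; rewrite !mxE; apply/mpolyP=> m; rewrite mcoeffD !mcoeff_filter mcoeffD.
by case: ifP; rewrite ?addr0.
Qed.

Section HomogMap.
Variables (r q : nat) (e : 'I_r -> nat) (e' : 'I_q -> nat) (phi : 'M[S]_(r, q)).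
Hypothesis phi_homog : homog_mx e e' phi.

Lemma row_degs_mul Q w : row_degs e Q w -> row_degs e' Q (w *m phi).
Proof.
move=> wQ b m; rewrite mxE => /msupp_sum_le /flatten_mapP[a _].
case/msuppM_le/allpairsP=> -[m1 m2] /= [m1w m2phi ->].
by rewrite mdegD -addnA (phi_homog m2phi); exact: wQ.
Qed.

Lemma row_filter_mul Q w : row_filter e' Q (w *m phi) = row_filter e Q w *m phi.
Proof.
rewrite -{1}(row_filterC e Q w) mulmxDl row_filterD.
rewrite [X in _ + X]row_filter0 ?addr0; last exact/row_degs_mul/row_filter_degs.
exact/row_filter_id/row_degs_mul/row_filter_degs.
Qed.

Lemma homog_lift Q w : row_degs e' Q (w *m phi) ->
  exists2 w', row_degs e Q w' & w *m phi = w' *m phi.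
Proof.
move=> wQ; exists (row_filter e Q w); first exact: row_filter_degs.
by rewrite -row_filter_mul row_filter_id.
Qed.

End HomogMap.
End GradedModules.

Section DimensionShift.
Variables (F : fieldType) (n : nat) (rho : 'I_n -> nat).
Hypothesis rho_inj : injective rho.
Local Notation S := {mpoly F[n]}.

Definition koszul_row q (c : {set 'I_n} -> 'rV[S]_q) A : 'rV[S]_q :=
  \row_b koszul rho (fun C => c C 0 b) A.

Definition koszul_degs q (e : 'I_q -> nat) p j (c : {set 'I_n} -> 'rV[S]_q) :=
  forall A b m, m \in msupp (c A 0 b) -> #|A| = p /\ (mdeg m + #|A| + e b = j)%N.

(* Tor_p(Z, F), computed as Koszul homology, is nonzero in degree j. *)
Definition tor_nz q (e : 'I_q -> nat) (Z : 'rV[S]_q -> Prop) p j : Prop :=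
  exists c, [/\ forall A, Z (c A), koszul_degs e p j c,
    forall A, koszul_row c A = 0 &
    ~ exists h, (forall A, Z (h A)) /\ forall A, c A = koszul_row h A].

Lemma eq_tor_nz q (e : 'I_q -> nat) (Z Z' : 'rV[S]_q -> Prop) p j :
  (forall v, Z v <-> Z' v) -> tor_nz e Z p j -> tor_nz e Z' p j.
Proof.
move=> ZZ' [c [Zc degc dc nc]]; exists c; split=> // [A|[h [Zh ch]]].
  exact/ZZ'.
by apply: nc; exists h; split=> // A; apply/ZZ'.
Qed.

Lemma koszul_rowB q (c c' : {set 'I_n} -> 'rV[S]_q) A :
  koszul_row (fun C => c C - c' C) A = koszul_row c A - koszul_row c' A.
Proof.
apply/rowP=> b; rewrite !mxE -koszulB.
by apply: eq_bigr => l _; rewrite !mxE.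
Qed.

Lemma koszul_rowK q (c : {set 'I_n} -> 'rV[S]_q) A :
  koszul_row (koszul_row c) A = 0.
Proof.
apply/rowP=> b; rewrite !mxE -[RHS](koszulK rho_inj (fun C => c C 0 b) A).
by apply: eq_bigr => l _; rewrite !mxE.
Qed.

Lemma koszul_row_mul r q (phi : 'M[S]_(r, q)) c A :
  koszul_row (fun C => c C *m phi) A = koszul_row c A *m phi.
Proof.
apply/rowP=> b; rewrite !mxE /koszul.
under eq_bigr => l _ do rewrite mxE mulr_sumr scaler_sumr.
rewrite exchange_big /=; apply: eq_bigr => a _.
by rewrite mxE mulr_suml; apply: eq_bigr => l _; rewrite mulrA scalerAl.
Qed.

Lemma mcoeff0_koszul_row q (c : {set 'I_n} -> 'rV[S]_q) A b :
  (koszul_row c A 0 b)@_0 = 0.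
Proof. by rewrite mxE mcoeff0_koszul. Qed.

Lemma koszul_row_exact q (c : {set 'I_n} -> 'rV[S]_q) :
  (forall A, koszul_row c A = 0) -> (forall b, (c set0 0 b)@_0 = 0) ->
  exists h, (forall A, koszul_row h A = c A) /\
    forall e p j, koszul_degs e p j c -> koszul_degs e p.+1 j h.
Proof.
move=> dc c0.
have ex b : exists h, (forall A, koszul rho h A = c A 0 b) /\
    forall p (Q : pred nat),
      (forall A m, m \in msupp (c A 0 b) -> #|A| = p /\ Q (mdeg m + #|A|)%N) ->
      (forall A m, m \in msupp (h A) -> #|A| = p.+1 /\ Q (mdeg m + #|A|)%N).
  apply: (koszul_exact rho_inj) => [A|//].
  by have /rowP/(_ b) := dc A; rewrite !mxE.
have [h hP] := fin_all_exists ex.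
exists (fun A => \row_b h b A); split=> [A|e p j cdeg A b m].
  apply/rowP=> b; rewrite mxE -[RHS](hP b).1.
  by apply: eq_bigr => l _; rewrite mxE.
rewrite mxE => /((hP b).2 p (fun t => t + e b == j)%N)[|-> /eqP //].
by move=> {}A {}m /cdeg[-> ->].
Qed.

Section Shift.
Variables (r q : nat) (e : 'I_r -> nat) (e' : 'I_q -> nat) (phi : 'M[S]_(r, q)).
Hypothesis phi_homog : homog_mx e e' phi.
Hypothesis phi_min : forall w, mx_kernel phi w -> forall a, (w 0 a)@_0 = 0.

Lemma tor_shift p j :
  tor_nz e' (mx_image phi) p.+1 j <-> tor_nz e (mx_kernel phi) p j.
Proof.
split=> -[c [Zc cdeg dc nc]].
  have ex (A : {set 'I_n}) : exists w : 'rV[S]_r, (forall b m, m \in msupp (w 0 b) ->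
      #|A| = p.+1 /\ (mdeg m + #|A| + e b = j)%N) /\ c A = w *m phi.
    have [w cw] := Zc A.
    have [|w' w'deg ww'] := @homog_lift _ _ _ _ _ _ _ phi_homog
        (fun t => (#|A| == p.+1) && (t + #|A| == j)%N) w.
      by move=> b m; rewrite -cw addnAC => /cdeg[-> <-]; rewrite !eqxx.
    exists w'; split; last by rewrite cw.
    by move=> b m /w'deg/andP[/eqP -> /eqP <-]; rewrite addnAC.
  have [c' c'E] := choice ex.
  have c'deg : koszul_degs e p.+1 j c' by move=> A b m /(c'E A).1.
  have c'P A := (c'E A).2.
  exists (koszul_row c'); split.
  - move=> A; rewrite /mx_kernel -koszul_row_mul -[RHS](dc A); congr koszul_row.
    by apply: functional_extensionality_dep => C; rewrite c'P.
  - move=> A b m; rewrite mxE => /msupp_sum_le /flatten_mapP[l].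
    rewrite mem_filter => /andP[lA _] /msuppZ_le /msuppM_le /allpairsP[[m1 m2]] /=.
    rewrite msuppX inE => -[/eqP -> /c'deg[cA dA] ->].
    move: cA dA; rewrite cardsU1 lA => -[<-] <-; split=> //.
    by rewrite mdegD mdeg1 [(1 + _)%N]addnC addnA.
  - exact: koszul_rowK.
  case=> h [hK c'h]; apply: nc.
  have [||g [gP _]] := @koszul_row_exact _ (fun A => c' A - h A).
  - by move=> A; rewrite koszul_rowB c'h subrr.
  - move=> b; rewrite mxE mcoeffD mxE mcoeffN (phi_min (hK _)) subr0.
    apply: memN_msupp_eq0; apply/negP=> /c'deg[]; by rewrite cards0.
  exists (fun A => g A *m phi); split=> [A|A]; first by exists (g A).
  by rewrite koszul_row_mul gP mulmxBl -c'P hK subr0.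
have c0 b : (c set0 0 b)@_0 = 0 by exact: (phi_min (Zc _)).
have [h [hP /(_ e p j cdeg) hdeg]] := koszul_row_exact dc c0.
exists (fun A => h A *m phi); split.
- by move=> A; exists (h A).
- move=> A b m mh.
  have := @row_degs_mul _ _ _ _ _ _ _ phi_homog
    (fun t => (#|A| == p.+1) && (t + #|A| == j)%N) (h A) _ b m mh.
  rewrite addnAC => /(_ _)/andP[|/eqP -> /eqP -> //].
  by move=> b' m' /hdeg[-> <-]; rewrite eqxx addnAC /=.
- by move=> A; rewrite koszul_row_mul hP; exact: Zc.
case=> g [Zg hg]; have [g' g'P] := choice Zg.
apply: nc; exists (fun A => h A - koszul_row g' A); split=> A.
  rewrite /mx_kernel mulmxBl hg -koszul_row_mul.
  suff -> : (fun C => g' C *m phi) = g by rewrite subrr.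
  by apply: functional_extensionality_dep => C; rewrite -g'P.
by rewrite koszul_rowB koszul_rowK subr0 hP.
Qed.

Lemma tor0_gen j : tor_nz e' (mx_image phi) 0 j <-> exists a, e a = j.
Proof.
split=> [[c [Zc cdeg dc nc]]|[a <-]].
  apply: contrapT => noj; apply: nc.
  have [w cw] := Zc set0.
  have [|w' w'deg ww'] := @homog_lift _ _ _ _ _ _ _ phi_homog (fun t => t == j)%N w.
    by move=> b m; rewrite -cw => /cdeg[_ <-]; rewrite cards0 addn0.
  have [||h [hP _]] := @koszul_row_exact _ (fun A => if A == set0 then w' else 0).
  - move=> A; apply/rowP=> b; rewrite !mxE /koszul big1 // => l lA.
    by rewrite -subset0 subUset sub1set inE mxE mulr0 scaler0.
  - move=> b; rewrite eqxx; apply: memN_msupp_eq0; apply/negP=> /w'deg.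
    by rewrite mdeg0 => /eqP eb; apply: noj; exists b.
  exists (fun A => h A *m phi); split=> A; first by exists (h A).
  rewrite koszul_row_mul hP; case: eqP => [->|/eqP nA]; first by rewrite cw ww'.
  rewrite mul0mx; apply/rowP=> b; rewrite mxE; apply: msuppnil0.
  case E: (msupp _) => [//|m s]; have : m \in msupp (c A 0 b) by rewrite E inE eqxx.
  by case/cdeg => /eqP; rewrite cards_eq0 (negPf nA).
exists (fun A => if A == set0 then delta_mx 0 a *m phi else 0); split.
- by move=> A; case: ifP => _; [exists (delta_mx 0 a)|exists 0; rewrite mul0mx].
- move=> A b m; case: eqP => [->|_]; last by rewrite mxE msupp0.
  by rewrite -rowE mxE => /phi_homog <-; rewrite cards0 addn0.
- move=> A; apply/rowP=> b; rewrite !mxE /koszul big1 // => l lA.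
  by rewrite -subset0 subUset sub1set inE mxE mulr0 scaler0.
case=> h [Zh hP]; have [h' h'P] := choice Zh.
have := hP set0; rewrite eqxx => E.
have /phi_min/(_ a) : mx_kernel phi (delta_mx 0 a - koszul_row h' set0).
  rewrite /mx_kernel mulmxBl E -koszul_row_mul.
  suff -> : (fun C => h' C *m phi) = h by rewrite subrr.
  by apply: functional_extensionality_dep => C; rewrite -h'P.
rewrite mxE mcoeffD mxE !eqxx /= mcoeff1 eqxx mxE mcoeffN mcoeff0_koszul_row subr0.
by move/eqP; rewrite oner_eq0.
Qed.

End Shift.
End DimensionShift.
Section TorOfIdeal.
Variables (F : fieldType) (n : nat) (rho : 'I_n -> nat).
Hypothesis rho_inj : injective rho.
Local Notation S := {mpoly F[n]}.
Implicit Types (I : classical_sets.set S) (D : pred {set 'I_n}).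

Definition ideal_row I (v : 'rV[S]_1) : Prop := I (v 0 0).

Definition ideal_tor_nz I i j : Prop := tor_nz rho (fun=> 0%N) (ideal_row I) i j.

Lemma min_gres_tor I (R : min_gres I) i j :
  (exists a : 'I_(res_rank R i), res_deg a = j) <-> ideal_tor_nz I i j.
Proof.
have aug_homog : homog_mx (@res_deg _ _ _ R 0) (fun=> 0%N) (res_aug R).
  by move=> a b m; rewrite (ord1 b) addn0; exact: res_aug_homog.
have diff_homog k : homog_mx (@res_deg _ _ _ R k.+1) (@res_deg _ _ _ R k) (res_diff R k).
  by move=> a b m; exact: res_diff_homog.
have diff_min k w : mx_image (res_diff R k) w -> forall a, (w 0 a)@_0 = 0.
  move=> [u ->] a; rewrite mxE raddf_sum big1 //= => b _.
  by rewrite (rmorphM (mcoeff 0%MM)) /= res_minimal mulr0.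
have aug_min w : mx_kernel (res_aug R) w -> forall a, (w 0 a)@_0 = 0.
  by move=> /res_exact0/(diff_min 0).
have ker_min k w : mx_kernel (res_diff R k) w -> forall a, (w 0 a)@_0 = 0.
  by move=> /res_exactS/(diff_min k.+1).
have augI v : mx_image (res_aug R) v <-> ideal_row I v.
  split=> [[w vE]|/(res_aug_onto R)[w vE]].
    by apply/(res_aug_onto R); exists w; rewrite vE.
  by exists w; apply/rowP=> b; rewrite (ord1 b).
have aug_tor p k : tor_nz rho (fun=> 0%N) (mx_image (res_aug R)) p k <-> ideal_tor_nz I p k.
  by split; apply: eq_tor_nz => v; rewrite augI.
have diff_tor k : forall p,
    tor_nz rho (@res_deg _ _ _ R k) (mx_image (res_diff R k)) p j <->
    ideal_tor_nz I (k.+1 + p) j.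
  elim: k => [|k IH] p.
    rewrite add1n -aug_tor (tor_shift rho_inj aug_homog aug_min).
    by split; apply: eq_tor_nz => v; rewrite /mx_kernel res_exact0.
  rewrite addSnnS -IH (tor_shift rho_inj (diff_homog k) (ker_min k)).
  by split; apply: eq_tor_nz => v; rewrite /mx_kernel res_exactS.
case: i => [|i].
  by rewrite -aug_tor (tor0_gen rho_inj aug_homog aug_min).
by rewrite -[X in ideal_tor_nz _ X]addn0 -diff_tor (tor0_gen rho_inj (diff_homog i) (ker_min i)).
Qed.

Lemma mnm_supp_mesym1 (U : {set 'I_n}) : mnm_supp (mesym1 U) = U.
Proof. by apply/setP=> i; rewrite inE mnmE; case: (i \in U). Qed.

Lemma mesym1_sub (U B : {set 'I_n}) : B \subset U -> (mesym1 U - mesym1 (U :\: B))%MM = mesym1 B.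
Proof.
move/subsetP=> BU; apply/mnmP=> i; rewrite mnmBE !mnmE !inE; have := BU i.
by case: (i \in B) => [->|_] //=; rewrite subnn.
Qed.

Section SquarefreeMonomial.
Variables (D : pred {set 'I_n}) (I : classical_sets.set S).
Hypothesis I_mono : forall f, I f <-> forall m, m \in msupp f -> ~~ D (mnm_supp m).

Lemma nonface_slice (x : {set 'I_n} -> S) b (B : {set 'I_n}) :
  (forall A, I (x A)) -> B \subset mnm_supp b ->
  slice rho b x B != 0 -> ~~ D (mnm_supp (b - mesym1 (mnm_supp b :\: B))).
Proof.
move=> Ix BU /slice_neq0[m mx bE]; have /I_mono/(_ m mx) := Ix (mnm_supp b :\: B).
by move: (mnm_supp b :\: B) mx bE => A mx ->; rewrite addmK.
Qed.

Lemma slice_boundary (x : {set 'I_n} -> S) p j (b : 'X_{1..n}) :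
  (forall A, I (x A)) -> (forall A, koszul rho x A = 0) ->
  (forall A m, m \in msupp (x A) -> #|A| = p /\ (mdeg m + #|A| = j)%N) ->
  ~ (exists U : {set 'I_n}, [/\ #|U| = j, (p <= j)%N & relcoh_nz F rho D U (j - p)]) ->
  exists g : {set 'I_n} -> F, [/\ forall B, (mdeg b != j) -> g B = 0,
    forall B : {set 'I_n}, B \subset mnm_supp b -> g B != 0 ->
      ~~ D (mnm_supp (b - mesym1 (mnm_supp b :\: B))) &
    forall B : {set 'I_n}, B \subset mnm_supp b -> slice rho b x B = cobd rho g B].
Proof.
move=> Ix dx xdeg noU; set U := mnm_supp b.
have df (B : {set 'I_n}) : B \subset U -> cobd rho (slice rho b x) B = 0.
  by move=> BU; rewrite -slice_koszul // /slice dx mcoeff0 mulr0.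
have fnz (B : {set 'I_n}) : B \subset U -> slice rho b x B != 0 ->
    mdeg b = j /\ (#|B| + p = #|U|)%N.
  move=> BU /slice_neq0[m /xdeg[cA mA] bE]; split.
    by rewrite bE mdegD mdeg_mesym1.
  by rewrite -cA cardsD (setIidPr BU) subnKC // subset_leq_card.
have [bj|bj] := eqVneq (mdeg b) j; last first.
  exists (fun=> 0); split=> // [B _|B BU]; first by rewrite eqxx.
  rewrite /cobd big1 => [|l _]; last by rewrite mulr0.
  by apply/eqP/negPn/negP => /(fnz B BU)[/eqP]; rewrite (negPf bj).
have [k bk|sqf] := pickP [pred k | 1 < b k]%N.
  have kU : k \in U by rewrite inE -lt0n ltnW.
  exists (cone rho k (slice rho b x)); split=> // [B BU|B BU].
    rewrite /cone; case: ifP => [|kB]; first by rewrite eqxx.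
    rewrite mulf_eq0 negb_or => /andP[_] /nonface_slice.
    rewrite subUset sub1set kU BU => /(_ Ix isT); congr (~~ D _).
    apply/setP=> l; rewrite !inE !mnmBE !mnmE !inE.
    have [->|//] := eqVneq l k; rewrite kB subn0 /=.
    by move: bk; rewrite /=; case: (b k) => [|[|t]].
  rewrite (cone_exact rho_inj kU BU) // => C CU _; exact: df.
have bE : b = mesym1 U.
  apply/mnmP=> i; rewrite mnmE inE; have := sqf i; rewrite /=.
  by case: (b i) => [|[|t]].
have cU : #|U| = j by rewrite -bj bE mdeg_mesym1.
have f0 (B : {set 'I_n}) : B \subset U -> D B -> slice rho b x B = 0.
  move=> BU DB; apply/eqP/negPn/negP => /(nonface_slice Ix BU).
  by rewrite -/U bE mesym1_sub // mnm_supp_mesym1 DB.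
have [lt_jp|le_pj] := ltnP j p.
  exists (fun=> 0); split=> // [B _|B BU]; first by rewrite eqxx.
  rewrite /cobd big1 => [|l _]; last by rewrite mulr0.
  apply/eqP/negPn/negP => /(fnz B BU)[_ E].
  by move: lt_jp; rewrite -cU -E ltnNge leq_addl.
have [g [g0 gf]] : exists g,
    (forall B : {set 'I_n}, B \subset U -> D B -> #|B|.+1 = (j - p)%N -> g B = 0) /\
    (forall B : {set 'I_n}, B \subset U -> #|B| = (j - p)%N -> slice rho b x B = cobd rho g B).
  apply: contrapT => nog; apply: noU; exists U; split=> //.
  exists (slice rho b x); split=> // B BU; first by move=> DB _; exact: f0.
  by move=> _; exact: df.
exists (fun B : {set 'I_n} => if (#|B|.+1 == j - p)%N then g B else 0); split=> [B|B BU|B BU].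
- by [].
- have [cB|_] := eqVneq #|B|.+1 (j - p)%N; last by rewrite eqxx.
  rewrite bE mesym1_sub // mnm_supp_mesym1.
  by apply: contraNN => DB; rewrite g0.
have cB1 l : l \in B -> #|B :\ l|.+1 = #|B| by move=> lB; rewrite (cardsD1 l B) lB.
have [cB|ncB] := eqVneq #|B| (j - p)%N.
  by rewrite gf //; apply: eq_cobd => l lB; rewrite cB1 // cB eqxx.
rewrite (_ : slice _ _ _ _ = 0).
  by rewrite /cobd big1 // => l lB; rewrite cB1 // (negPf ncB) mulr0.
apply/eqP/negPn/negP => /(fnz B BU)[_ E].
by move: ncB; rewrite -cU -E addnK eqxx.
Qed.

Lemma tor_relcoh p j : ideal_tor_nz I p j <->
  exists U : {set 'I_n}, [/\ #|U| = j, (p <= j)%N & relcoh_nz F rho D U (j - p)].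
Proof.
split=> [[c [Ic cdeg dc nc]]|[U [cU le_pj [f [f0 df nf]]]]].
  apply: contrapT => noU; apply: nc; pose x (A : {set 'I_n}) : S := c A 0 0.
  have xdeg (A : {set 'I_n}) m : m \in msupp (x A) -> #|A| = p /\ (mdeg m + #|A| = j)%N.
    by move=> /cdeg; rewrite addn0.
  have dx A : koszul rho x A = 0.
    by have /rowP/(_ 0) := dc A; rewrite !mxE.
  have Ix A : I (x A) by exact: Ic.
  have [g gP] := choice (fun b => slice_boundary b Ix dx xdeg noU).
  have [b B leb|h [hg hsupp]] := @slice_surj _ _ rho j.+1 g.
    by have [-> //] := gP b; rewrite gtn_eqF.
  exists (fun A => const_mx (h A)); split=> A.
    rewrite /ideal_row mxE; apply/I_mono=> m; rewrite mcoeff_msupp => /hsupp.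
    set b := (m + _)%MM; set B := _ :\: _ => gB.
    have [_ /(_ B (subsetDl _ _) gB) + _] := gP b.
    have -> : mnm_supp b :\: B = A.
      by rewrite setDDr setDv set0U mnm_suppD; apply/setIidPr; exact: subsetUl.
    by rewrite addmK.
  apply/rowP=> b; rewrite (ord1 b) mxE.
  transitivity (koszul rho h A); last by apply: eq_bigr => l _; rewrite mxE.
  suff /(_ A) : x =1 koszul rho h by [].
  apply: (slice_inj (rho := rho)) => {}b B BU; rewrite slice_koszul //.
  have [_ _ ->] := gP b; rewrite //.
  by apply: eq_cobd => l lB; rewrite hg // (subset_trans (subD1set _ _)).
pose G (b : 'X_{1..n}) (B : {set 'I_n}) : F :=
  if (b == mesym1 U) && (#|B| == j - p)%N then f B else 0.
have [b B leb|x [xG xsupp]] := @slice_surj _ _ rho j.+1 G.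
  by rewrite /G; case: eqP leb => [->|]; rewrite // mdeg_mesym1 cU ltnn.
have xdeg (A : {set 'I_n}) m : m \in msupp (x A) -> [/\ A \subset U, (m + mesym1 A = mesym1 U)%MM,
    mnm_supp m = U :\: A, #|U :\: A| = (j - p)%N & f (U :\: A) != 0].
  rewrite mcoeff_msupp => /xsupp; rewrite /G.
  case: ifP => [/andP[/eqP bE /eqP cB] fB|]; last by rewrite eqxx.
  rewrite bE mnm_supp_mesym1 in cB fB; split=> //.
    by rewrite -(mnm_supp_mesym1 U) -bE mnm_suppD subsetUl.
  apply/setP=> i; have /mnmP/(_ i) := bE; rewrite mnmDE !mnmE !inE.
  by case: (i \in A); case: (i \in U); case: (m i) => [|[|t]].
have koszul_degx A m : m \in msupp (x A) -> #|A| = p /\ (mdeg m + #|A| = j)%N.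
  move=> /xdeg[AU mE _ cA _]; rewrite -{2}mdeg_mesym1 -mdegD mE mdeg_mesym1; split=> //.
  have := cardsID A U; rewrite (setIidPr AU) cA cU.
  by move/eqP; rewrite -{2}(subnKC le_pj) eqn_add2r => /eqP.
have slice0 b (B : {set 'I_n}) : B \subset mnm_supp b -> b != mesym1 U -> slice rho b x B = 0.
  by move=> BU nb; rewrite xG // /G (negPf nb).
have dx : koszul rho x =1 fun=> 0.
  apply: (slice_inj (rho := rho)) => b B BU; rewrite slice_koszul //.
  rewrite [RHS]/slice mcoeff0 mulr0 (@eq_cobd _ _ _ _ (G b)); last first.
    by move=> l lB; rewrite xG // (subset_trans (subD1set _ _)).
  have [bE|nb] := eqVneq b (mesym1 U); last first.
    by rewrite /cobd big1 // => l lB; rewrite /G (negPf nb) mulr0.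
  have cB1 l : l \in B -> #|B| = #|B :\ l|.+1 by move=> lB; rewrite (cardsD1 l B) lB.
  have [cB|ncB] := eqVneq #|B| (j - p).+1.
    rewrite -(df B) //; last by move: BU; rewrite bE mnm_supp_mesym1.
    apply: eq_cobd => l lB; rewrite /G bE eqxx /=.
    by move: cB; rewrite (cB1 l lB) => -[->]; rewrite eqxx.
  rewrite /cobd big1 // => l lB; rewrite /G.
  by move: ncB; rewrite (cB1 l lB) eqSS => /negPf ->; rewrite andbF mulr0.
exists (fun A => const_mx (x A)); split.
- move=> A; rewrite /ideal_row mxE; apply/I_mono=> m /xdeg[AU _ -> cA].
  by apply: contraNN => DA; rewrite f0 // subsetDl.
- by move=> A b m; rewrite mxE addn0 => /koszul_degx.
- move=> A; apply/rowP=> b; rewrite !mxE -[RHS](dx A).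
  by apply: eq_bigr => l _; rewrite mxE.
case=> h [Ih xh]; apply: nf.
pose h' (A : {set 'I_n}) : S := h A 0 0.
have xh' : x =1 koszul rho h'.
  by move=> A; have /rowP/(_ 0) := xh A; rewrite !mxE.
exists (slice rho (mesym1 U) h'); split=> B BU.
  move=> DB _; apply/eqP/negPn/negP.
  move/(@nonface_slice h' (mesym1 U)); rewrite mnm_supp_mesym1 mesym1_sub //.
  by rewrite mnm_supp_mesym1 DB => /(_ Ih BU).
move=> cB; rewrite -slice_koszul ?mnm_supp_mesym1 //.
have : slice rho (mesym1 U) x B = f B by rewrite xG ?mnm_supp_mesym1 // /G cB !eqxx.
by rewrite /slice mnm_supp_mesym1 xh'.
Qed.

End SquarefreeMonomial.
End TorOfIdeal.
Section Dickson.
Variable n : nat.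

Lemma dickson (ks : seq 'I_n) (L : 'X_{1..n} -> Prop) :
  exists s : seq 'X_{1..n}, (forall m, m \in s -> L m) /\
    forall m, L m -> exists2 m' : 'X_{1..n}, m' \in s & forall i, i \in ks -> (m' i <= m i)%N.
Proof.
elim: ks L => [|k ks IH] L.
  have [[m Lm]|noL] := pselect (exists m, L m).
    exists [:: m]; split=> [m'|m' _]; first by rewrite inE => /eqP ->.
    by exists m; rewrite ?inE.
  by exists [::]; split=> // m Lm; case: noL; exists m.
have [s0 [s0L s0P]] := IH L.
have [s sP] := choice (fun t => IH (fun m => L m /\ m k = t)).
pose N := (\max_(m <- s0) m k)%N.
exists (s0 ++ flatten [seq s t | t <- iota 0 N]); split=> [m|m Lm].
  rewrite mem_cat => /orP[/s0L //|/flatten_mapP[t _ mt]].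
  by case: ((sP t).1 m mt).
have [lt_mN|le_Nm] := ltnP (m k) N.
  have [m' m's m'P] := (sP (m k)).2 m (conj Lm erefl).
  exists m'.
    by rewrite mem_cat; apply/orP; right; apply/flatten_mapP; exists (m k); rewrite ?mem_iota.
  move=> i; rewrite inE => /orP[/eqP ->|/m'P //].
  by case: ((sP (m k)).1 m' m's) => _ ->.
have [m' m's m'P] := s0P m Lm.
exists m'; first by rewrite mem_cat m's.
move=> i; rewrite inE => /orP[/eqP ->|/m'P //].
by apply: leq_trans le_Nm; rewrite /N (big_rem m') //= leq_maxl.
Qed.

End Dickson.

Section Noetherian.
Variables (F : fieldType) (n : nat).
Local Notation S := {mpoly F[n]}.

Definition submod q (Y : 'rV[S]_q -> Prop) : Prop :=
  Y 0 /\ forall p v w, Y v -> Y w -> Y (p *: v + w).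

Lemma submodD q (Y : 'rV[S]_q -> Prop) v w : submod Y -> Y v -> Y w -> Y (v + w).
Proof. by case=> _ YP Yv Yw; rewrite -[v]scale1r; exact: YP. Qed.

Lemma submodZ q (Y : 'rV[S]_q -> Prop) p v : submod Y -> Y v -> Y (p *: v).
Proof. by case=> Y0 YP Yv; rewrite -[_ *: _]addr0; exact: YP. Qed.

Lemma submod_sum q (Y : 'rV[S]_q -> Prop) (J : Type) (s : seq J) (P : pred J) (f : J -> 'rV[S]_q) :
  submod Y -> (forall i, P i -> Y (f i)) -> Y (\sum_(i <- s | P i) f i).
Proof.
move=> YP Yf; apply: (big_ind Y) => //; first by case: YP.
by move=> v w; exact: submodD.
Qed.

Lemma submod_image r q (phi : 'M[S]_(r, q)) : submod (mx_image phi).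
Proof.
split; first by exists 0; rewrite mul0mx.
by move=> p _ _ [v ->] [w ->]; exists (p *: v + w); rewrite mulmxDl scalemxAl.
Qed.

Lemma mx_image_row r q (phi : 'M[S]_(r, q)) i : mx_image phi (row i phi).
Proof. by exists (delta_mx 0 i); rewrite rowE. Qed.

Lemma mlead_reduce (p u : S) : p != 0 -> u != 0 -> (mlead u <= mlead p)%MM ->
  let p' := p - (mleadc p / mleadc u) *: 'X_[mlead p - mlead u] * u in
  p' != 0 -> (mlead p' < mlead p)%O.
Proof.
move=> p0 u0 le_up p' p'0.
set c := mleadc p / mleadc u in p' p'0 *.
have c0 : c != 0 by rewrite mulf_neq0 ?invr_eq0 ?mleadc_eq0.
have X0 : 'X_[mlead p - mlead u] != 0 :> S by rewrite -msupp_eq0 msuppX.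
have lead_t : mlead (c *: 'X_[mlead p - mlead u] * u) = mlead p.
  by rewrite -scalerAl mleadZ // mleadM // mleadXm submK.
have coef_u : ('X_[mlead p - mlead u] * u)@_(mlead p) = mleadc u.
  have -> : mlead p = (mlead p - mlead u + mlead u)%MM by rewrite submK.
  by rewrite addmK mulrC mcoeffMX.
have p'c : p'@_(mlead p) = 0.
  rewrite mcoeffB -scalerAl mcoeffZ coef_u divfK ?subrr //.
  by rewrite mleadc_eq0.
rewrite lt_neqAle; apply/andP; split.
  by apply: contra_neq p'0 => E; apply/eqP; rewrite -mleadc_eq0 E p'c.
by apply: le_trans (mleadB_le _ _) _; rewrite lead_t joinxx.
Qed.

Lemma submod_fg q (Y : 'rV[S]_q -> Prop) : submod Y ->
  exists s : seq 'rV[S]_q, (forall u, u \in s -> Y u) /\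
    forall Z, submod Z -> (forall u, u \in s -> Z u) -> forall v, Y v -> Z v.
Proof.
move=> Ysub.
suff H k : (k <= q)%N -> exists s : seq 'rV[S]_q, (forall u, u \in s -> Y u) /\
    forall Z, submod Z -> (forall u, u \in s -> Z u) ->
    forall v, Y v -> (forall a : 'I_q, (a < q - k)%N -> v 0 a = 0) -> Z v.
  have [s [sY sP]] := H q (leqnn q).
  exists s; split=> // Z Zsub Zs v Yv; apply: sP => // a.
  by rewrite subnn.
elim: k => [|k IH] lekq.
  exists [::]; split=> // Z [Z0 _] _ v _ v0.
  suff -> : v = 0 by [].
  by apply/rowP=> a; rewrite v0 ?mxE // subn0.
have [s [sY sP]] := IH (ltnW lekq).
have lt_q : (q - k.+1 < q)%N by lia.
pose a0 := Ordinal lt_q.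
pose L m := exists v, [/\ Y v, forall a : 'I_q, (a < q - k.+1)%N -> v 0 a = 0,
  v 0 a0 != 0 & mlead (v 0 a0) = m].
have [t [tL tP]] := dickson (enum 'I_n) L.
have ex m : exists v, L m -> [/\ Y v, forall a : 'I_q, (a < q - k.+1)%N -> v 0 a = 0,
    v 0 a0 != 0 & mlead (v 0 a0) = m].
  have [[v vP]|noL] := pselect (L m); first by exists v.
  by exists 0 => /noL.
have [u uP] := choice ex.
exists (s ++ map u t); split=> [v|Z Zsub Zs].
  by rewrite mem_cat => /orP[/sY //|/mapP[m /tL/uP[Yu _ _ _] ->]].
have Zle v : Y v -> (forall a : 'I_q, (a < q - k.+1)%N -> v 0 a = 0) -> v 0 a0 = 0 -> Z v.
  move=> Yv v0 va0; apply: sP Yv _ => // [w ws|a lta].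
    by apply: Zs; rewrite mem_cat ws.
  have [->//|na] := eqVneq a a0; apply: v0.
  have : val a != (q - k.+1)%N by apply: contra_neq na => E; apply/val_inj.
  by move: lta; rewrite /=; lia.
suff {}H m v : Y v -> (forall a : 'I_q, (a < q - k.+1)%N -> v 0 a = 0) ->
    mlead (v 0 a0) = m -> Z v.
  by move=> v Yv v0; apply: (H (mlead (v 0 a0))).
elim/(@ltmwf n): m v => m IHm v Yv v0 vm.
have [va0|va0] := eqVneq (v 0 a0) 0; first exact: Zle.
have /tP[m' m't le_m'm] : L (mlead (v 0 a0)) by exists v.
have [Yu u0 ua0 um'] := uP m' (tL m' m't).
have le_lead : (mlead (u m' 0 a0)%R <= mlead (v 0 a0)%R)%MM.
  by rewrite um'; apply/mnm_lepP=> i; apply: le_m'm; rewrite mem_enum.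
have := mlead_reduce va0 ua0 le_lead.
set c := _ *: _ => /= lead_lt.
have Zu : Z (u m') by apply: Zs; rewrite mem_cat map_f ?orbT.
have -> : v = c *: u m' + (v - c *: u m') by rewrite addrC subrK.
apply: submodD => //; first exact: submodZ.
have Yv' : Y (v - c *: u m').
  by rewrite addrC -scaleNr; apply: (Ysub.2).
have v'0 (a : 'I_q) : (a < q - k.+1)%N -> (v - c *: u m') 0 a = 0.
  by move=> lta; rewrite !mxE v0 // u0 // mulr0 subr0.
have [v'a0|v'a0] := eqVneq ((v - c *: u m') 0 a0) 0; first exact: Zle.
apply: IHm Yv' v'0 erefl; rewrite -vm !mxE; apply: lead_lt.
by move: v'a0; rewrite !mxE.
Qed.

End Noetherian.
Section MinimalGenerators.
Variables (F : fieldType) (n : nat).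
Local Notation S := {mpoly F[n]}.

Definition graded_submod q (e : 'I_q -> nat) (Y : 'rV[S]_q -> Prop) : Prop :=
  submod Y /\ forall v Q, Y v -> Y (row_filter e Q v).

Definition homog_gens q (e : 'I_q -> nat) (Y : 'rV[S]_q -> Prop) r : Prop :=
  exists (d : 'I_r -> nat) (phi : 'M[S]_(r, q)),
    homog_mx d e phi /\ forall v, Y v <-> mx_image phi v.

Lemma homog_gens_ex q (e : 'I_q -> nat) (Y : 'rV[S]_q -> Prop) :
  graded_submod e Y -> exists r, homog_gens e Y r.
Proof.
case=> Ysub Ygr; have [s [sY sP]] := submod_fg Ysub.
pose N (v : 'rV[S]_q) := (\max_b (msize (v 0%R b) + e b))%N.
pose ps := [seq (j, v) | v <- s, j <- iota 0 (N v)].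
pose p0 : nat * 'rV[S]_q := (0%N, 0).
pose d (i : 'I_(size ps)) := (nth p0 ps i).1.
pose phi := \matrix_(i < size ps) row_filter e (pred1 (d i)) (nth p0 ps i).2.
exists (size ps), d, phi; split=> [i b m|v].
  by rewrite mxE => /row_filter_degs/eqP.
split=> [|[w ->]].
  apply: sP; first exact: submod_image.
  move=> u us; pose f j := row_filter e (pred1 j) u.
  have -> : u = \sum_(0 <= j < N u) f j.
    apply/rowP=> b; rewrite summxE; apply/mpolyP=> m; rewrite raddf_sum /=.
    under eq_bigr => j _ do rewrite mxE mcoeff_filter /=.
    have [mu|mNu] := boolP (m \in msupp (u 0 b)); last first.
      by rewrite memN_msupp_eq0 // big1 // => j _; case: ifP.
    have lt_m : (mdeg m + e b < N u)%N.
      apply: leq_trans (leq_bigmax (F := fun b => (msize (u 0%R b) + e b)%N) b).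
      by rewrite ltn_add2r msize_mdeg_lt.
    rewrite (big_rem (mdeg m + e b)%N) ?mem_index_iota //= eqxx big_seq big1 ?addr0 //.
    by move=> j; rewrite mem_rem_uniq ?iota_uniq // inE eq_sym => /andP[/negPf ->].
  rewrite big_seq; apply: submod_sum => [|j]; first exact: submod_image.
  rewrite mem_index_iota /= => lt_j.
  have jups : (j, u) \in ps by apply/allpairsPdep; exists u, j; rewrite mem_iota.
  have lt_i : (index (j, u) ps < size ps)%N by rewrite index_mem.
  have := mx_image_row phi (Ordinal lt_i).
  by rewrite rowK /d /= nth_index.
rewrite mulmx_sum_row; apply: submod_sum => // i _; apply: submodZ => //.
rewrite rowK; apply: Ygr; have : nth p0 ps i \in ps by exact: mem_nth.
by case/allpairsPdep=> u [j [us _ ->]]; exact: sY.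
Qed.

(* A relation with a unit coefficient makes the corresponding generator redundant. *)
Lemma homog_gens_drop q (e : 'I_q -> nat) (Y : 'rV[S]_q -> Prop) r
    (d : 'I_r.+1 -> nat) (phi : 'M[S]_(r.+1, q)) w a :
  homog_mx d e phi -> (forall v, Y v <-> mx_image phi v) ->
  mx_kernel phi w -> (w 0 a)@_0 != 0 -> homog_gens e Y r.
Proof.
move=> phi_homog Yphi w0 wa; pose w' := row_filter d (pred1 (d a)) w.
have w'0 : w' *m phi = 0.
  rewrite -(row_filter_mul phi_homog) w0 row_filter0 // => b m.
  by rewrite mxE msupp0.
pose c := (w 0 a)@_0.
have w'a : w' 0 a = c%:MP.
  apply/mpolyP=> m; rewrite mxE mcoeff_filter mcoeffC /= -[X in _ == X]add0n eqn_add2r.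
  rewrite mdeg_eq0; case: eqP => [->|]; by rewrite ?mulr1 ?mulr0.
exists (d \o lift a), (row' a phi); split=> [i b m|v].
  by rewrite mxE; exact: phi_homog.
have dropE (u : 'rV[S]_r.+1) : u 0 a = 0 -> u *m phi = col' a u *m row' a phi.
  move=> ua; apply/rowP=> b; rewrite !mxE (bigD1_ord a) //= ua mul0r add0r.
  by apply: eq_bigr => i _; rewrite !mxE.
rewrite Yphi; split=> -[u ->].
  exists (col' a (u - (u 0 a * c^-1%:MP) *: w')); rewrite -dropE.
    by rewrite mulmxBl -scalemxAl w'0 scaler0 subr0.
  by rewrite mxE [X in _ + X]mxE [X in _ - X]mxE w'a -mulrA -mpolyCM mulVf // mulr1 subrr.
exists (\row_i if unlift a i is Some k then u 0 k else 0).
rewrite dropE ?mxE ?unlift_none //; congr (_ *m _).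
by apply/rowP=> i; rewrite !mxE liftK.
Qed.

Lemma min_gens q (e : 'I_q -> nat) (Y : 'rV[S]_q -> Prop) :
  graded_submod e Y -> exists r (d : 'I_r -> nat) (phi : 'M[S]_(r, q)),
    [/\ homog_mx d e phi, forall v, Y v <-> mx_image phi v &
        forall w, mx_kernel phi w -> forall a, (w 0 a)@_0 = 0].
Proof.
move=> /homog_gens_ex exr.
have exb : exists r, `[< homog_gens e Y r >] by case: exr => r /asboolT; exists r.
case: (ex_minnP exb) => r /asboolP[d [phi [phi_homog Yphi]]] r_min.
exists r, d, phi; split=> // w w0 a; apply: contrapT => /eqP wa.
case: r => [|r] in d phi phi_homog Yphi r_min w w0 a wa *; first by case: a {wa}.
have /r_min : `[< homog_gens e Y r >].
  exact/asboolP/(homog_gens_drop phi_homog Yphi w0 wa).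
by rewrite ltnn.
Qed.

Lemma graded_kernel r q (d : 'I_r -> nat) (e : 'I_q -> nat) (phi : 'M[S]_(r, q)) :
  homog_mx d e phi -> graded_submod d (mx_kernel phi).
Proof.
move=> phi_homog; split; first split; rewrite /mx_kernel.
- by rewrite mul0mx.
- by move=> p v w v0 w0; rewrite mulmxDl -scalemxAl v0 w0 scaler0 addr0.
move=> v Q v0; rewrite -(row_filter_mul phi_homog) v0 row_filter0 // => b m.
by rewrite mxE msupp0.
Qed.

(* A free module together with the graded submodule that remains to be resolved. *)
Record stage := Stage {
  st_rank : nat;
  st_deg : 'I_st_rank -> nat;
  st_sub : 'rV[S]_st_rank -> Prop;
  st_graded : graded_submod st_deg st_sub
}.

Lemma next_stage_ex (s : stage) : exists (s' : stage) (phi : 'M[S]_(st_rank s', st_rank s)),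
  [/\ homog_mx (@st_deg s') (@st_deg s) phi,
      forall v, st_sub v <-> mx_image phi v,
      forall w : 'rV_(st_rank s'), st_sub w <-> mx_kernel phi w &
      forall w : 'rV_(st_rank s'), st_sub w -> forall a, (w 0 a)@_0 = 0].
Proof.
have [r [d [phi [phi_homog Yphi phi_min]]]] := min_gens (st_graded s).
by exists (Stage (graded_kernel phi_homog)), phi.
Qed.

Let next_stage s := projT1 (cid (next_stage_ex s)).
Let stage_map s : 'M[S]_(st_rank (next_stage s), st_rank s) :=
  projT1 (cid (projT2 (cid (next_stage_ex s)))).

Lemma stage_mapP s :
  [/\ homog_mx (@st_deg (next_stage s)) (@st_deg s) (stage_map s),
      forall v, st_sub v <-> mx_image (stage_map s) v,
      forall w : 'rV_(st_rank (next_stage s)), st_sub w <-> mx_kernel (stage_map s) w &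
      forall w : 'rV_(st_rank (next_stage s)), st_sub w -> forall a, (w 0 a)@_0 = 0].
Proof. exact: (projT2 (cid (projT2 (cid (next_stage_ex s))))). Qed.

Lemma min_gres_ex (I : classical_sets.set S) :
  graded_submod (fun=> 0%N) (@ideal_row F n I) -> inhabited (min_gres I).
Proof.
move=> I_graded; pose s0 := Stage I_graded.
pose st i := iter i next_stage s0.
constructor.
apply: (@MinGRes F n I (fun i => st_rank (st i.+1)) (fun i => @st_deg (st i.+1))
          (stage_map s0) (fun i => stage_map (st i.+1))).
- by move=> a m; have [H _ _ _] := stage_mapP s0; move=> /H <-; rewrite addn0.
- by move=> i a b m; have [H _ _ _] := stage_mapP (st i.+1); exact: H.
- move=> f; have [_ H _ _] := stage_mapP s0.
  have := H (const_mx f); rewrite /= /ideal_row mxE => ->.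
  split=> -[w wE]; exists w; first by rewrite -wE mxE.
  by apply/rowP=> b; rewrite mxE (ord1 b).
- move=> v; have [_ _ H _] := stage_mapP s0; have [_ H' _ _] := stage_mapP (st 1%N).
  by rewrite -[_ = 0]/(mx_kernel (stage_map s0) v) -H H'.
- move=> i v; have [_ _ H _] := stage_mapP (st i.+1).
  have [_ H' _ _] := stage_mapP (st i.+2).
  by rewrite -[_ = 0]/(mx_kernel (stage_map (st i.+1)) v) -H H'.
move=> i a b; have [_ H _ _] := stage_mapP (st i.+1).
have [_ _ _ H'] := stage_mapP (st i).
have /H' /(_ b) : st_sub (row a (stage_map (st i.+1))) by apply/H/mx_image_row.
by rewrite mxE.
Qed.

End MinimalGenerators.

Lemma mono_ideal_graded (F : fieldType) n (D : pred {set 'I_n})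
    (I : classical_sets.set {mpoly F[n]}) : down_closed D ->
  (forall f, I f <-> forall m, m \in msupp f -> ~~ D (mnm_supp m)) ->
  graded_submod (fun=> 0%N) (@ideal_row F n I).
Proof.
move=> dD I_mono; split; first split; rewrite /ideal_row.
- by rewrite mxE; apply/I_mono=> m; rewrite msupp0.
- move=> p v w /I_mono Iv /I_mono Iw; apply/I_mono=> m; rewrite !mxE.
  move/msuppD_le; rewrite mem_cat => /orP[|/Iw //].
  move=> /msuppM_le/allpairsP[[m1 m2] /= [_ /Iv Dm2 ->]].
  apply: contraNN Dm2; apply: dD; apply/subsetP=> i.
  by rewrite !inE mnmDE addn_eq0 negb_and => ->; rewrite orbT.
move=> v Q /I_mono Iv; apply/I_mono=> m; rewrite mxE mcoeff_msupp mcoeff_filter.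
by case: ifP; rewrite ?eqxx // -mcoeff_msupp => _ /Iv.
Qed.
Section BettiNumbers.
Variable F : fieldType.

Lemma relcoh_card (R : comNzRingType) (K : finType) (rho : K -> nat) D U k :
  relcoh_nz R rho D U k -> (k <= #|U|)%N.
Proof.
case=> f [_ _ nf]; rewrite leqNgt; apply: contra_notN nf => lt_Uk.
exists (fun=> 0); split=> // B /subset_leq_card le_BU cB.
by move: lt_Uk; rewrite -cB ltnNge le_BU.
Qed.

Lemma betti_tor n (rho : 'I_n -> nat) (I : classical_sets.set {mpoly F[n]}) i j :
  injective rho -> betti I i j <> 0%N -> ideal_tor_nz rho I i j.
Proof.
move=> rho_inj; rewrite /betti; case: xgetP => [b _ [R ->]|//] /eqP.
rewrite cards_eq0 => /set0Pn[a]; rewrite inE => /eqP aj.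
by apply/(min_gres_tor rho_inj R); exists a.
Qed.

Lemma tor_betti n (rho : 'I_n -> nat) (I : classical_sets.set {mpoly F[n]}) i j :
  injective rho -> inhabited (min_gres I) -> ideal_tor_nz rho I i j -> betti I i j <> 0%N.
Proof.
move=> rho_inj [R] tor_ij; rewrite /betti; case: xgetP => [b _ [R' ->]|no]; last first.
  by have := no _ (ex_intro _ R erefl).
have /(min_gres_tor rho_inj R')[a aj] := tor_ij.
by apply/eqP; rewrite cards_eq0; apply/set0Pn; exists a; rewrite inE aj.
Qed.

Lemma leq_max_nat (A : classical_sets.set nat) N r :
  A r -> (forall s, A s -> (s <= N)%N) -> (r <= max_nat A)%N.
Proof.
move=> Ar AN; have exA : exists s, `[< A s >] by exists r; exact/asboolP.
have leN s : `[< A s >] -> (s <= N)%N by move=> /asboolP/AN.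
case: (ex_maxnP exA leN) => t /asboolP At t_max.
rewrite /max_nat; case: xgetP => [s _ [_ s_max]|no]; first exact: s_max.
by case: (no t); split=> // s As; apply/t_max/asboolP.
Qed.

Lemma max_nat_in (A : classical_sets.set nat) r : max_nat A = r.+1 -> A r.+1.
Proof. by rewrite /max_nat; case: xgetP => // s _ [As _] <-. Qed.

End BettiNumbers.

Section CliqueComplex.
Variables (F : fieldType) (T : finType).
Implicit Types (G H M : sgraph T) (B U : {set T}).

Definition clique H B : bool :=
  (B \subset verts H) && [forall x in B, forall y in B, (x != y) ==> adj H x y].

Lemma cliqueP H B : reflect (B \subset verts H /\
  forall x y, x \in B -> y \in B -> x != y -> adj H x y) (clique H B).
Proof.
apply: (iffP andP) => -[BH HB]; split=> //.
  by move=> x y xB yB; apply/implyP; move/forall_inP/(_ x xB)/forall_inP/(_ y yB): HB.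
by apply/forall_inP=> x xB; apply/forall_inP=> y yB; apply/implyP; exact: HB.
Qed.

Lemma clique_down H : down_closed (clique H).
Proof.
move=> B C /subsetP CB /cliqueP[BH HB]; apply/cliqueP; split.
  by apply: subset_trans BH; apply/subsetP.
by move=> x y /CB xB /CB yB; exact: HB.
Qed.

Definition vrank (x : T) : nat := enum_rank x.

Lemma vrank_inj : injective vrank.
Proof. by move=> x y /val_inj/enum_rank_inj. Qed.

Definition vertex H : 'I_#|verts H| -> T := enum_val.
Arguments vertex : clear implicits.

Lemma vertex_inj H : injective (vertex H).
Proof. exact: enum_val_inj. Qed.

Lemma sub_vertex H B : (B \subset vertex H @: setT) = (B \subset verts H).
Proof.
congr (_ \subset pred_of_set _); apply/setP=> y; apply/imsetP/idP=> [[i _ ->]|yH].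
  exact: enum_valP.
by exists (enum_rank_in yH y); rewrite // /vertex enum_rankK_in.
Qed.

Definition label H : 'I_#|verts H| -> nat := vrank \o vertex H.
Arguments label : clear implicits.

Lemma label_inj H : injective (label H).
Proof. exact: (inj_comp vrank_inj (@vertex_inj H)). Qed.

Definition index_clique H (B : {set 'I_#|verts H|}) : bool := clique H (vertex H @: B).

Lemma index_clique_down H : down_closed (@index_clique H).
Proof. by move=> B C CB; apply: clique_down; apply: imsetS. Qed.

Lemma ideal_gen_sum (R : comNzRingType) (K : finType) (P : pred K) (g : K -> R)
    (J : Type) (s : seq J) (Q : pred J) (f : J -> R) :
  (forall i, Q i -> ideal_gen P g (f i)) -> ideal_gen P g (\sum_(i <- s | Q i) f i).
Proof.
move=> gf; apply: (big_ind (ideal_gen P g)) => [|u v [c ->] [c' ->]|i Qi].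
- by exists (fun=> 0); rewrite big1 // => k _; rewrite mul0r.
- exists (fun k => c k + c' k); rewrite -big_split.
  by apply: eq_bigr => k _; rewrite mulrDl.
- exact: gf.
Qed.

Lemma nonedge_ideal_mono H f : nonedge_ideal F H f <->
  forall m, m \in msupp f -> ~~ index_clique (mnm_supp m).
Proof.
split=> [[c ->] m|fm].
  move=> /msupp_sum_le/flatten_mapP[[a b]]; rewrite mem_filter /= => /andP[/andP[ab nab] _].
  move=> /msuppM_le/allpairsP[[m1 m2] /= [_]].
  rewrite -mpolyXD msuppX inE => /eqP -> ->.
  apply: contra nab => /cliqueP[_]; apply; last by rewrite (inj_eq enum_val_inj).
    by rewrite imset_f // inE !mnmDE mnm1E eqxx addnCA.
  by rewrite imset_f // inE !mnmDE !mnm1E eqxx !addnA addn1.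
rewrite (mpolyE f) big_seq; apply: ideal_gen_sum => m mf.
have [a [b [ma mb ab nab]]] : exists a b, [/\ m a != 0%N, m b != 0%N, a != b &
    ~~ adj H (vertex H a) (vertex H b)].
  apply: contrapT => no; move/negP: (fm m mf); apply; apply/cliqueP; split.
    by rewrite -sub_vertex imsetS ?subsetT.
  move=> _ _ /imsetP[a ma ->] /imsetP[b mb ->]; rewrite (inj_eq (@vertex_inj H)) => ab.
  rewrite !inE in ma mb; apply/negPn/negP => nab; apply: no.
  by exists a, b.
have le_abm : (U_(a) + U_(b) <= m)%MM.
  apply/mnm_lepP=> i; rewrite mnmDE !mnm1E.
  case: (eqVneq a i) ab ma => [-> ib|_ _ _]; last first.
    by case: (eqVneq b i) mb => [->|//]; rewrite lt0n.
  by rewrite [b == i]eq_sym (negPf ib) addn0 lt0n.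
exists (fun k => if k == (a, b) then f@_m *: 'X_[m - (U_(a) + U_(b))] else 0).
rewrite (bigD1 (a, b)) /=; last by rewrite ab.
rewrite eqxx big1 ?addr0 => [|k /andP[_ /negPf ->]]; last by rewrite mul0r.
by rewrite -scalerAl -!mpolyXD submK.
Qed.

Lemma nonedge_gres H : inhabited (min_gres (nonedge_ideal F H)).
Proof.
apply: min_gres_ex; apply: mono_ideal_graded (@index_clique_down H) _ => f.
exact: nonedge_ideal_mono.
Qed.

Lemma tor_nonedge H i r : ideal_tor_nz (label H) (nonedge_ideal F H) i (i + r) <->
  exists U : {set 'I_#|verts H|}, #|U| = (i + r)%N /\ relcoh_nz F (label H) (@index_clique H) U r.
Proof.
rewrite (tor_relcoh (@label_inj H) (@nonedge_ideal_mono H)).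
split=> -[U []]; first by move=> cU _; rewrite addKn => rU; exists U.
by move=> cU rU; exists U; rewrite addKn leq_addr.
Qed.

Lemma relcoh_clique H (U : {set 'I_#|verts H|}) k :
  relcoh_nz F (label H) (@index_clique H) U k.+1 ->
  coh_nz F vrank (fun B => clique H B && (B \subset vertex H @: U)) k.
Proof.
move=> rU; apply/(coh_nz_imset F vrank (@vertex_inj H)).
  by move=> B /andP[/cliqueP[BH _] _]; rewrite sub_vertex.
have U0 : U != set0.
  by rewrite -card_gt0; apply: leq_trans (relcoh_card rU).
have /(coh_relcoh F (@label_inj H) _ (@index_clique_down H) U0) cU := rU.
apply: eq_coh_nz cU => B.
rewrite sub_imset_pre; congr (_ && (B \subset pred_of_set _)).
by apply/setP=> i; rewrite inE mem_imset //; exact: vertex_inj.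
Qed.

Lemma clique_relcoh H (U : {set T}) k : U \subset verts H ->
  coh_nz F vrank (fun B => clique H B && (B \subset U)) k.+1 ->
  relcoh_nz F (label H) (@index_clique H) (vertex H @^-1: U) k.+2.
Proof.
move=> UH /(coh_nz_imset F vrank (@vertex_inj H)) cU.
have {cU} cU : coh_nz F (label H)
    (fun B : {set 'I_#|verts H|} => index_clique B && (B \subset vertex H @^-1: U)) k.+1.
  apply: eq_coh_nz (cU _) => [B|B /andP[/cliqueP[BH _] _]]; last by rewrite sub_vertex.
  by rewrite sub_imset_pre.
apply/(coh_relcoh F (@label_inj H)) => //; first exact: index_clique_down.
apply/negP=> /eqP U0; apply: (@coh_simplex F _ _ (@label_inj H) set0 k).
apply: eq_coh_nz cU => B; rewrite U0 subset0; case: eqP => [->|_]; rewrite ?andbF // andbT.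
by apply/cliqueP; rewrite imset0 sub0set; split=> // x y; rewrite inE.
Qed.

Lemma leq_reg H U k :
  coh_nz F vrank (fun B => clique H B && (B \subset U)) k.+1 -> (k.+2 <= reg F H)%N.
Proof.
move=> cU; have {cU} : coh_nz F vrank (fun B => clique H B && (B \subset U :&: verts H)) k.+1.
  apply: eq_coh_nz cU => B; rewrite subsetI; case: cliqueP => //= -[-> _].
  by rewrite andbT.
move: (U :&: verts H) (subsetIr U (verts H)) => {}U UH cU.
rewrite /reg; case: ifP => [/forall_inP complH|_].
  case: (@coh_simplex F _ _ vrank_inj U k); apply: eq_coh_nz cU => B.
  apply/andP/idP=> [[]//|BU]; split=> //; apply/cliqueP.
  have BH := subset_trans BU UH; split=> // x y /(subsetP BH) xH /(subsetP BH) yH.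
  by apply/implyP; move/forall_inP/(_ y yH): (complH x xH).
have rU := clique_relcoh UH cU; have := relcoh_card rU.
set U' := _ @^-1: U in rU * => le_kU.
apply: (@leq_max_nat _ #|verts H|).
  exists (#|U'| - k.+2)%N; apply: (tor_betti (@label_inj H) (nonedge_gres H)).
  by apply/tor_nonedge; exists U'; rewrite subnK.
move=> s [i /(betti_tor (@label_inj H))/tor_nonedge[V [cV _]]].
by rewrite -[X in (_ <= X)%N]card_ord (leq_trans _ (max_card V)) // cV leq_addl.
Qed.

Lemma reg_coh H k : reg F H = k.+2 ->
  exists U, coh_nz F vrank (fun B => clique H B && (B \subset U)) k.+1.
Proof.
rewrite /reg; case: ifP => // _ /max_nat_in[i].
move=> /(betti_tor (@label_inj H))/tor_nonedge[U [_ /relcoh_clique cU]].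
by exists (vertex H @: U).
Qed.

Lemma reg_gt0 H : (0 < reg F H)%N.
Proof.
have [cH|] := boolP (complete H); first by rewrite /reg cH.
rewrite negb_forall_in => /exists_inP[x xH]; rewrite negb_forall_in => /exists_inP[y yH].
rewrite negb_imply => /andP[xy nxy].
have c1 z : z \in verts H -> clique H [set z].
  move=> zH; apply/cliqueP; rewrite sub1set; split=> // u v.
  by rewrite !inE => /eqP -> /eqP ->; rewrite eqxx.
apply: leq_trans (@leq_reg H [set x; y] 0 _) => //.
apply: (coh_two_points F vrank xy (c1 x xH) (c1 y yH)).
by apply: contra nxy => /cliqueP[_]; apply; rewrite // !inE eqxx ?orbT.
Qed.

Lemma clique_del_edges H M B :
  clique (del_edges H M) B =
  clique H B && [forall x in B, forall y in B, ~~ adj M x y].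
Proof.
apply/cliqueP/andP=> [[BH HB]|[/cliqueP[BH HB] /forall_inP MB]]; split=> //.
- by apply/cliqueP; split=> // x y xB yB xy; have /andP[] := HB x y xB yB xy.
- apply/forall_inP=> x xB; apply/forall_inP=> y yB.
  have [->|xy] := eqVneq x y; first by rewrite adj_irr.
  by have /andP[] := HB x y xB yB xy.
move=> x y xB yB xy; rewrite /= /del_adj HB //=.
by move/forall_inP: (MB x xB); apply.
Qed.

Lemma clique_local_graph G M B :
  clique (local_graph G M) B = clique G B && (B \subset verts M :|: common_nbrs G M).
Proof.
apply/cliqueP/andP=> [[]|[/cliqueP[BG GB] BW]].
  rewrite subsetI => /andP[BG BW] GB; split=> //; apply/cliqueP; split=> // x y xB yB xy.
  by have /and3P[] := GB x y xB yB xy.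
split; first by rewrite subsetI BG.
by move=> x y xB yB xy; apply/and3P; split; [exact: (subsetP BW)|exact: (subsetP BW)|exact: GB].
Qed.

Lemma clique_del_local G M B :
  clique G B = clique (del_edges G M) B || clique (local_graph G M) B.
Proof.
rewrite clique_del_edges clique_local_graph -andb_orr.
case: cliqueP => //= -[BG GB]; apply/esym/orP.
have [noM|] := boolP [forall x in B, forall y in B, ~~ adj M x y]; first by left.
rewrite negb_forall_in => /exists_inP[i iB]; rewrite negb_forall_in => /exists_inP[j jB].
rewrite negbK => Mij; right; apply/subsetP=> k kB; rewrite !inE.
have /andP[iM jM] := adj_verts Mij.
have [->|ki] := eqVneq k i; first by rewrite iM.
have [->|kj] := eqVneq k j; first by rewrite jM.
apply/orP; right; apply/existsP; exists i; apply/existsP; exists j.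
by rewrite Mij !GB // eq_sym.
Qed.

End CliqueComplex.

Local Close Scope ring_scope.

Theorem theorem1p8 (F : fieldType) (charF0 : [pchar F]%R =i pred0)
    (T : finType) (G M : sgraph T) (sMG : subgraph M G) :
  reg F G <= maxn (reg F (del_edges G M))
                  (maxn (reg F (local_graph G M))
                        (reg F (del_edges (local_graph G M) M) + 1)).
Proof.
rewrite !leq_max addn1.
case regG: (reg F G) => [|[|k]]; rewrite ?reg_gt0 ?orbT //.
have [U cU] := reg_coh regG.
have down H : down_closed (fun B : {set T} => clique H B && (B \subset U)).
  move=> B C CB /andP[HB BU]; apply/andP.
  by split; [exact: clique_down CB HB|exact: subset_trans CB BU].
have split_U B : clique G B && (B \subset U) =
    (clique (del_edges G M) B && (B \subset U)) || (clique (local_graph G M) B && (B \subset U)).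
  by rewrite -andb_orl -clique_del_local.
have [/leq_reg ->|/leq_reg ->|c12] :=
  mayer_vietoris (@vrank_inj T) (down _) (down _) split_U cU; rewrite ?orbT //.
apply/or3P; constructor 3; rewrite ltnS.
case: k {regG cU} c12 => [_|k cU]; first exact: reg_gt0.
apply: (@leq_reg F T _ U); apply: eq_coh_nz cU => B.
rewrite clique_del_edges [clique (del_edges _ _) _]clique_del_edges clique_local_graph.
by case: (clique G B); case: (B \subset U); rewrite ?andbT ?andbF //= andbC.
Qed.
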